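(* Let $S,S^\perp$ be two curves in $\mathbb R^{2,2}$ representing the two one-parameter families of lines $L,L^\perp$ in $3$-space. Then $S,S^\perp$ are a pair of non-degenerate conjugate conics in $\mathbb R^{2,2}$ if and only if $L$ and $L^\perp$ are the two families of generating lines of a non-planar doubly ruled surface in $3$-space.
   Context: $\mathbb R^{2,2}$ is $\mathbb R^4$ with the bilinear form $\langle\underline x,\underline x'\rangle=x_1x_1'+x_2x_2'-x_3x_3'-x_4x_4'$ and $\|\underline x\|^2=\langle\underline x,\underline x\rangle$. $\mathbb R^{2,2}$ is regarded as a local chart of the space of lines in $3$-space: a line with Plücker coordinates $p_1,p_2,p_3,q_1,q_2,q_3$ (with $(q_1,q_2,q_3)$ the direction and $(p_1,p_2,p_3)$ the moment $X\times q$, $X$ a point of the line) is represented by $$\underline x=\left(\frac{p_2+q_2}{q_3},\frac{-p_1-q_1}{q_3},\frac{p_2-q_2}{q_3},\frac{-p_1+q_1}{q_3}\right)\in\mathbb R^{2,2}.$$ Horizontal lines ($q_3=0$) and improper lines (lines at infinity) are not covered by these coordinates; they are ''at infinity'' in $\mathbb R^{2,2}$. A non-planar doubly ruled surface is either a one-sheeted hyperboloid or a hyperbolic paraboloid; the two foliations by lines that it admits are its two families of generating lines. $\mathbb R^{3,3}$ is $\mathbb R^6$, with vectors written $\mathbf s=(s_0,\underline s,s_5)$, $\underline s\in\mathbb R^{2,2}$, and bilinear form $(\mathbf s,\mathbf s')=s_0s_0'+\langle\underline s,\underline s'\rangle-s_5s_5'$. For $\underline x\in\mathbb R^{2,2}$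 put $\mathbf s_{\underline x}=\left(\tfrac{1-\|\underline x\|^2}{2},\underline x,\tfrac{1+\|\underline x\|^2}{2}\right)$, a null vector of $\mathbb R^{3,3}$. Let $J$ be the Gram matrix of $(\cdot,\cdot)$ and $O^\pm(3,3)=\{\Lambda\in GL(6):\Lambda^TJ\Lambda=\pm J\}$. A conformal map $f$ of $\mathbb R^{2,2}$ is the (possibly only partially defined) transformation induced by some $\Lambda\in O^\pm(3,3)$: $f(\underline x)$ is the point such that $\mathbf s_{f(\underline x)}$ is a nonzero multiple of $\Lambda\mathbf s_{\underline x}$; the points $\underline x$ for which $\Lambda\mathbf s_{\underline x}$ satisfies $s_0+s_5=0$ are sent to infinity. The image of a set under $f$ consists of the points $f(\underline x)$ for $\underline x$ in the set not sent to infinity (so it may be empty). Let $S_0=\{(\alpha_1,\alpha_2,0,0):\alpha_1^2+\alpha_2^2=1\}$ and $S_0^\perp=\{(0,0,\beta_1,\beta_2):\beta_1^2+\beta_2^2=1\}$. A pair of non-degenerate conjugate conics $S,S^\perp$ is the image of $S_0,S_0^\perp$ under a conformal map of $\mathbb R^{2,2}$. *)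

(* Defs.v *)
From HB Require Import structures.
From mathcomp Require Import all_boot all_order all_algebra.
From mathcomp Require Import all_classical reals.

Set Implicit Arguments.
Unset Strict Implicit.
Unset Printing Implicit Defensive.

Import Order.TTheory GRing.Theory Num.Theory.
Local Open Scope classical_set_scope.
Local Open Scope ring_scope.

(* Coordinates are indexed from 0, so that x_1, ..., x_4 of R^{2,2} are
   x 0 0, x 1 0, x 2 0, x 3 0, and similarly in 3-space; in R^{3,3} the
   indices 0, ..., 5 are those of s_0, ..., s_5. *)

Section Pseudo.
Variable R : realType.

Definition form22 (x y : 'cV[R]_4) : R :=
  x 0 0 * y 0 0 + x 1 0 * y 1 0 - x 2 0 * y 2 0 - x 3 0 * y 3 0.

Definition sqnorm22 (x : 'cV[R]_4) : R := form22 x x.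

Definition form33 (s t : 'cV[R]_6) : R :=
  s 0 0 * t 0 0
  + form22 (\col_(i < 4) s (inord i.+1) 0) (\col_(i < 4) t (inord i.+1) 0)
  - s 5 0 * t 5 0.

Definition gram33 : 'M[R]_6 :=
  \matrix_(i, j) form33 (delta_mx i 0) (delta_mx j 0).

Definition lift33 (x : 'cV[R]_4) : 'cV[R]_6 :=
  \col_(i < 6) [:: (1 - sqnorm22 x) / 2; x 0 0; x 1 0; x 2 0; x 3 0;
                   (1 + sqnorm22 x) / 2]`_i.

Definition Opm33 : set 'M[R]_6 :=
  [set M | M \in unitmx /\
     (M^T *m gram33 *m M = gram33 \/ M^T *m gram33 *m M = - gram33)].

(* The graph of the partial map induced by M.  Since s_0 + s_5 = 1 for
   lift33 y, no y is related to x when M *m lift33 x has s_0 + s_5 = 0. *)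
Definition conformal (M : 'M[R]_6) (x y : 'cV[R]_4) : Prop :=
  exists c : R, c != 0 /\ lift33 y = c *: (M *m lift33 x).

Definition conformal_image (M : 'M[R]_6) (A : set 'cV[R]_4) : set 'cV[R]_4 :=
  [set y | exists2 x, A x & conformal M x y].

Definition circle0 : set 'cV[R]_4 :=
  [set x | x 0 0 ^+ 2 + x 1 0 ^+ 2 = 1 /\ x 2 0 = 0 /\ x 3 0 = 0].

Definition circle0_perp : set 'cV[R]_4 :=
  [set x | x 0 0 = 0 /\ x 1 0 = 0 /\ x 2 0 ^+ 2 + x 3 0 ^+ 2 = 1].

Definition conjugate_conics (S Sperp : set 'cV[R]_4) : Prop :=
  exists M, [/\ Opm33 M, S = conformal_image M circle0
                & Sperp = conformal_image M circle0_perp].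

End Pseudo.

Section Lines.
Variable R : realType.

Definition cross (u v : 'cV[R]_3) : 'cV[R]_3 :=
  \col_(i < 3) [:: u 1 0 * v 2 0 - u 2 0 * v 1 0;
                   u 2 0 * v 0 0 - u 0 0 * v 2 0;
                   u 0 0 * v 1 0 - u 1 0 * v 0 0]`_i.

Definition line (X q : 'cV[R]_3) : set 'cV[R]_3 :=
  [set Y | exists t : R, Y = X + t *: q].

Definition lines : set (set 'cV[R]_3) :=
  [set l | exists X q : 'cV[R]_3, q != 0 /\ l = line X q].

Definition nonhorizontal_lines : set (set 'cV[R]_3) :=
  [set l | exists X q : 'cV[R]_3, q 2 0 != 0 /\ l = line X q].

Definition chart (p q : 'cV[R]_3) : 'cV[R]_4 :=
  \col_(i < 4) [:: (p 1 0 + q 1 0) / q 2 0; (- p 0 0 - q 0 0) / q 2 0;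
                   (p 1 0 - q 1 0) / q 2 0; (- p 0 0 + q 0 0) / q 2 0]`_i.

Definition point_of_line (l : set 'cV[R]_3) (x : 'cV[R]_4) : Prop :=
  exists X q : 'cV[R]_3, [/\ q 2 0 != 0, l = line X q & x = chart (cross X q) q].

(* Horizontal lines of F have no point in R^{2,2} and do not contribute. *)
Definition represents (S : set 'cV[R]_4) (F : set (set 'cV[R]_3)) : Prop :=
  S = [set x | exists2 l, F l & point_of_line l x].

Definition same_nonhorizontal (F G : set (set 'cV[R]_3)) : Prop :=
  F `&` nonhorizontal_lines = G `&` nonhorizontal_lines.

Definition affine_image (A : 'M[R]_3) (b : 'cV[R]_3) (Q : set 'cV[R]_3) :
    set 'cV[R]_3 :=
  [set A *m X + b | X in Q].

Definition one_sheeted_hyperboloid (Q : set 'cV[R]_3) : Prop :=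
  exists (A : 'M[R]_3) (b : 'cV[R]_3), A \in unitmx /\
    Q = affine_image A b
          [set X | X 0 0 ^+ 2 + X 1 0 ^+ 2 - X 2 0 ^+ 2 = 1].

Definition hyperbolic_paraboloid (Q : set 'cV[R]_3) : Prop :=
  exists (A : 'M[R]_3) (b : 'cV[R]_3), A \in unitmx /\
    Q = affine_image A b [set X | X 2 0 = X 0 0 ^+ 2 - X 1 0 ^+ 2].

Definition nonplanar_doubly_ruled (Q : set 'cV[R]_3) : Prop :=
  one_sheeted_hyperboloid Q \/ hyperbolic_paraboloid Q.

Definition line_foliation (Q : set 'cV[R]_3) (F : set (set 'cV[R]_3)) : Prop :=
  [/\ F `<=` lines, forall l, F l -> l `<=` Q
    & forall X, Q X -> exists! l, F l /\ l X].

Definition generating_families (Q : set 'cV[R]_3)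
    (G Gperp : set (set 'cV[R]_3)) : Prop :=
  G <> Gperp /\ forall F, line_foliation Q F <-> F = G \/ F = Gperp.

End Lines.

(* Main.v *)
(** Through Pluecker coordinates a line with moment p and direction q is a null
    vector of the Klein form 2 p.q on R^6, and the chart of R^{2,2} is, up to
    the factor 2, an isometry from this quadratic space to R^{3,3}.  Hence a
    pair of conjugate conics is the trace on the Klein quadric of two
    complementary orthogonal 3-planes V, W of signatures (2,1) and (1,2), and
    what remains is to classify such planes under affine maps of 3-space,
    which act as similarities of the Klein form.  If V contains no line at
    infinity, it is a graph p = K q; a translation removes the skew part of K,
    and a linear map turns its symmetric part into diag(1,1,-1): the quadric is
    a one-sheeted hyperboloid.  Otherwise V contains exactly one line at
    infinity and an adapted affine frame exhibits a hyperbolic paraboloid.  On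
    these two model surfaces every line belongs to one of two rulings, and lines
    of different rulings meet unless they are parallel; a foliation mixing both
    rulings would then consist of just two lines, so there is no third one. *)
Require Import Defs.
From HB Require Import structures.
From mathcomp Require Import all_boot all_order all_algebra.
From mathcomp Require Import all_classical reals.
From mathcomp Require Import ring lra.

Set Implicit Arguments.
Unset Strict Implicit.
Unset Printing Implicit Defensive.

Import Order.TTheory GRing.Theory Num.Theory.
Local Open Scope classical_set_scope.
Local Open Scope ring_scope.

(** * Vectors of 3-space *)

Section Coordinates.
Variable R : realType.
Implicit Types (u v w X Y p q r b : 'cV[R]_3) (A : 'M[R]_3) (a : R).

Lemma ord3P (P : 'I_3 -> Prop) : P 0 -> P 1 -> P 2 -> forall i, P i.
Proof.
by move=> P0 P1 P2 [[|[|[|//]]] lti]; [move: P0 | move: P1 | move: P2];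
  congr P; apply: val_inj.
Qed.

Lemma ord6P (P : 'I_6 -> Prop) :
  P 0 -> P 1 -> P 2 -> P 3 -> P 4 -> P 5 -> forall i, P i.
Proof.
by move=> P0 P1 P2 P3 P4 P5 [[|[|[|[|[|[|//]]]]]] lti];
  [move: P0 | move: P1 | move: P2 | move: P3 | move: P4 | move: P5];
  congr P; apply: val_inj.
Qed.

Lemma sum3E (F : 'I_3 -> R) : \sum_i F i = F 0 + F 1 + F 2.
Proof.
rewrite !big_ord_recl big_ord0 addr0 addrA.
by congr (F _ + F _ + F _); apply: val_inj.
Qed.

Lemma sum6E (F : 'I_6 -> R) :
  \sum_i F i = F 0 + F 1 + F 2 + F 3 + F 4 + F 5.
Proof.
rewrite !big_ord_recl big_ord0 addr0 !addrA.
by congr (F _ + F _ + F _ + F _ + F _ + F _); apply: val_inj.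
Qed.

Lemma cV3P u v :
  u 0 0 = v 0 0 -> u 1 0 = v 1 0 -> u 2 0 = v 2 0 -> u = v.
Proof.
by move=> e0 e1 e2; apply/colP; apply: ord3P.
Qed.

Lemma mulmxv3E m (A : 'M[R]_(m, 3)) u i :
  (A *m u) i 0 = A i 0 * u 0 0 + A i 1 * u 1 0 + A i 2 * u 2 0.
Proof. by rewrite mxE sum3E. Qed.

Definition vec3 (a b c : R) : 'cV[R]_3 := \col_(i < 3) [:: a; b; c]`_i.

Lemma vec3E (a b c : R) :
  (vec3 a b c 0 0 = a) * (vec3 a b c 1 0 = b) * (vec3 a b c 2 0 = c).
Proof. by rewrite /vec3 !mxE. Qed.

Lemma crossE u v :
  (cross u v 0 0 = u 1 0 * v 2 0 - u 2 0 * v 1 0) *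
  (cross u v 1 0 = u 2 0 * v 0 0 - u 0 0 * v 2 0) *
  (cross u v 2 0 = u 0 0 * v 1 0 - u 1 0 * v 0 0).
Proof. by rewrite /cross !mxE. Qed.

Definition dot u v : R := u 0 0 * v 0 0 + u 1 0 * v 1 0 + u 2 0 * v 2 0.

Lemma dotE u v : dot u v = (u^T *m v) 0 0.
Proof. by rewrite mulmxv3E !mxE. Qed.

Lemma dot_eq0 u : (dot u u == 0) = (u == 0).
Proof.
apply/idP/eqP => [/eqP|->]; last by rewrite /dot !mxE !mul0r !addr0.
rewrite /dot => u0.
have h (i : 'I_3) : u i 0 ^+ 2 = 0.
  move: i; apply: ord3P; nra.
by apply: cV3P; apply/eqP; rewrite !mxE -sqrf_eq0 h.
Qed.

Lemma det3E A : \det A =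
  A 0 0 * (A 1 1 * A 2 2 - A 1 2 * A 2 1)
  - A 0 1 * (A 1 0 * A 2 2 - A 1 2 * A 2 0)
  + A 0 2 * (A 1 0 * A 2 1 - A 1 1 * A 2 0).
Proof.
have l00 : lift 0 0 = 1 :> 'I_3 by apply: val_inj.
have l01 : lift 0 1 = 2 :> 'I_3 by apply: val_inj.
have l10 : lift 1 0 = 0 :> 'I_3 by apply: val_inj.
have l11 : lift 1 1 = 2 :> 'I_3 by apply: val_inj.
have l20 : lift 2 0 = 0 :> 'I_3 by apply: val_inj.
have l21 : lift 2 1 = 1 :> 'I_3 by apply: val_inj.
have det2 (B : 'M[R]_2) : \det B = B 0 0 * B 1 1 - B 0 1 * B 1 0.
  rewrite (expand_det_row _ 0) !big_ord_recl big_ord0 /cofactor.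
  rewrite !det_mx11 !mxE /= addr0 expr0 mul1r expr1 mulN1r mulrN.
  by congr (B _ _ * B _ _ - B _ _ * B _ _); apply: val_inj.
rewrite (expand_det_row _ 0) sum3E /cofactor !det2 !mxE /=.
rewrite l00 l01 l10 l11 l20 l21.
by ring.
Qed.

Definition columns_mx u v w : 'M[R]_3 :=
  \matrix_(i, j) nth 0 [:: u i 0; v i 0; w i 0] j.

Lemma mul_columns_mx u v w X :
  columns_mx u v w *m X = X 0 0 *: u + X 1 0 *: v + X 2 0 *: w.
Proof. by apply: cV3P; rewrite mulmxv3E !mxE /=; ring. Qed.

Lemma det_columns_mx u v w : \det (columns_mx u v w) = dot (cross u v) w.
Proof. by rewrite det3E /dot !crossE !mxE /=; ring. Qed.

Definition cross_mx b : 'M[R]_3 :=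
  \matrix_(i, j) nth 0 (nth [::] [:: [:: 0; - b 2 0; b 1 0];
    [:: b 2 0; 0; - b 0 0]; [:: - b 1 0; b 0 0; 0]] i) j.

Lemma mul_cross_mx b u : cross_mx b *m u = cross b u.
Proof. by apply: cV3P; rewrite mulmxv3E !crossE /cross_mx !mxE /=; ring. Qed.

Lemma tr_cross_mx b : (cross_mx b)^T = - cross_mx b.
Proof.
by apply/matrixP; apply: ord3P; apply: ord3P; rewrite !mxE /= ?oppr0 ?opprK.
Qed.

(** The cofactor matrix of an invertible [A]: moments transform by it when directions transform by
    [A]. *)
Definition cof A : 'M[R]_3 := \det A *: (invmx A)^T.

(** After multiplication by [A^T] this is det(A u, A v, A e_i) = det A det(u, v, e_i), a polynomial
    identity. *)
Lemma cross_mulmx A u v : A \in unitmx ->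
  cross (A *m u) (A *m v) = cof A *m cross u v.
Proof.
move=> uA; have uAt : A^T \in unitmx by rewrite unitmx_tr.
apply: (can_inj (mulKmx uAt)); rewrite /cof -scalemxAl -scalemxAr.
rewrite mulmxA -trmx_mul mulVmx // trmx1 mul1mx.
by apply: cV3P; rewrite mulmxv3E [RHS]mxE !crossE !mulmxv3E det3E !mxE; ring.
Qed.

Lemma dotC u v : dot u v = dot v u.
Proof. by rewrite /dot; ring. Qed.

Lemma dot0v u : dot 0 u = 0.
Proof. by rewrite /dot !mxE !mul0r !addr0. Qed.

Lemma dotDl u v w : dot (u + v) w = dot u w + dot v w.
Proof. by rewrite /dot !mxE; ring. Qed.

Lemma dotZl a u w : dot (a *: u) w = a * dot u w.
Proof. by rewrite /dot !mxE; ring. Qed.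

Lemma crossC u v : cross u v = - cross v u.
Proof. by apply: cV3P; rewrite !(crossE, mxE); ring. Qed.

Lemma cross0v u : cross 0 u = 0.
Proof. by apply: cV3P; rewrite !(crossE, mxE); ring. Qed.

Lemma crossv0 u : cross u 0 = 0.
Proof. by rewrite crossC cross0v oppr0. Qed.

Lemma crossZr u v a : cross u (a *: v) = a *: cross u v.
Proof. by apply: cV3P; rewrite !(crossE, mxE); ring. Qed.

Lemma crossZl u v a : cross (a *: u) v = a *: cross u v.
Proof. by rewrite crossC crossZr -scalerN -crossC. Qed.

Lemma cross_self q : cross q q = 0.
Proof. by apply: cV3P; rewrite !(crossE, mxE); ring. Qed.

Lemma dot_cross u v w : dot (cross u v) w = dot u (cross v w).
Proof. by rewrite /dot !crossE; ring. Qed.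

Lemma cross_cross u v w : cross (cross u v) w = dot u w *: v - dot v w *: u.
Proof. by apply: cV3P; rewrite !crossE !mxE /dot; ring. Qed.

Lemma parallel_vectors q r : q != 0 -> cross q r = 0 ->
  r = (dot q r / dot q q) *: q.
Proof.
rewrite -dot_eq0 => nq qr.
have /eqP : dot q q *: r - dot r q *: q = 0.
  by rewrite -cross_cross qr cross0v.
rewrite subr_eq0 => /eqP e; rewrite mulrC -scalerA dotC -e scalerA mulVf //.
by rewrite scale1r.
Qed.

(** The first hypothesis says that [Y - X] is orthogonal to [cross q r], so that X + t q = Y + s r
    is solvable; [t] and [s] come from taking the cross product of this equation with [r] and with
    [q]. *)
Lemma coplanar_lines_meet X q Y r :
  dot (cross X q) r + dot (cross Y r) q = 0 -> cross q r != 0 ->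
  exists2 Z, line X q Z & line Y r Z.
Proof.
move=> h; rewrite -dot_eq0; set n := cross q r => n0.
set t := dot (cross (Y - X) r) n / dot n n.
set s := dot (cross (Y - X) q) n / dot n n.
exists (X + t *: q); first by exists t.
exists s; apply/eqP; rewrite -subr_eq0; apply/eqP.
have hn : dot (X - Y) n = 0.
  by rewrite -[RHS]h /n /dot !crossE !mxE; ring.
apply: (@scalerI _ _ (dot n n)) => //.
have -> : dot n n *: (X + t *: q - (Y + s *: r)) =
    dot n n *: (X - Y) + dot (cross (Y - X) r) n *: q
    - dot (cross (Y - X) q) n *: r.
  by rewrite /t /s; apply: cV3P; rewrite !mxE; field.
(* Expanding [X - Y] in the basis [q], [r], [n] leaves only the multiple [dot (X - Y) n] of [n],
   which is zero. *)
rewrite scaler0 -[RHS](scale0r n) -[in RHS]hn /n.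
by apply: cV3P; rewrite /dot !(mxE, crossE) /=; ring.
Qed.

End Coordinates.

(** * Rulings spanned by 3-planes of Pluecker vectors *)

Section Families.
Variable R : realType.
Implicit Types (X Y Z q r b : 'cV[R]_3) (A : 'M[R]_3) (V : 'M[R]_(3 + 3, 3)).
Implicit Types (Q g h l : set 'cV[R]_3) (F G : set (set 'cV[R]_3)).

Lemma line_base X q : line X q X.
Proof. by exists 0; rewrite scale0r addr0. Qed.

Lemma cross_line X q Y : line X q Y -> cross Y q = cross X q.
Proof. by move=> [t ->]; apply: cV3P; rewrite !(crossE, mxE); ring. Qed.

Lemma line_rebase X q Y a : a != 0 -> line X q Y -> line X q = line Y (a *: q).
Proof.
move=> a0 [t ->]; apply/seteqP; split => [Z [s ->]|Z [s ->]].
  exists ((s - t) / a); rewrite scalerA divfK // -addrA -scalerDl.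
  by rewrite subrKC.
by exists (t + s * a); rewrite scalerDl addrA scalerA.
Qed.

Lemma line_rebase1 X q Y : line X q Y -> line X q = line Y q.
Proof. by move=> lY; rewrite (line_rebase (oner_neq0 R) lY) scale1r. Qed.

Lemma line_two_points X q Y Z : line X q Y -> line X q Z -> Y != Z ->
  line X q = line Y (Z - Y).
Proof.
move=> /line_rebase1 -> [t ->]; rewrite addrAC subrr add0r => neq.
apply: line_rebase (line_base _ _).
by apply: contraNneq neq => ->; rewrite scale0r addr0.
Qed.

Lemma lines_meet_once l h Y Z :
  lines l -> lines h -> l Y -> h Y -> l Z -> h Z ->
  Y != Z -> l = h.
Proof.
move=> [X [q [_ ->]]] [X' [q' [_ ->]]] lY hY lZ hZ neq.
by rewrite (line_two_points lY lZ) // (line_two_points hY hZ).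
Qed.

Lemma line_next X q : q != 0 -> line X q (X + q) /\ X != X + q.
Proof.
move=> q0; split; first by exists 1; rewrite scale1r.
by rewrite -subr_eq0 opprD addNKr oppr_eq0.
Qed.

Lemma line_eq_direction X q Y r : q != 0 -> r != 0 -> line X q = line Y r ->
  exists2 a, a != 0 & r = a *: q.
Proof.
move=> q0 r0 e; have [lYr neq] := line_next Y r0.
have lY := line_base Y r; rewrite -e in lY lYr.
case: lY lYr neq => t -> [s e'] neq.
have er : r = (s - t) *: q.
  by apply: (addrI (X + t *: q)); rewrite e' -addrA -scalerDl subrKC.
by exists (s - t) => //; apply: contraNneq r0 => e0; rewrite er e0 scale0r.
Qed.

Lemma eq_line_moment X Y q : q != 0 -> cross X q = cross Y q ->
  line X q = line Y q.
Proof.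
move=> q0 e; apply: line_rebase1; exists (dot q (Y - X) / dot q q).
rewrite -(parallel_vectors q0) ?subrKC //.
rewrite -(subrr (cross X q)) {2}e.
by apply: cV3P; rewrite !(crossE, mxE); ring.
Qed.

(** * Pluecker vectors and the ruling cut out by a 3-plane *)

Definition plucker X q : 'cV[R]_(3 + 3) := col_mx (cross X q) q.

Lemma plucker_line X q Y : line X q Y -> plucker Y q = plucker X q.
Proof. by move=> lY; rewrite /plucker (cross_line lY). Qed.

Lemma pluckerZ X q a : plucker X (a *: q) = a *: plucker X q.
Proof. by rewrite /plucker crossZr scale_col_mx. Qed.

Definition colspan V (w : 'cV[R]_(3 + 3)) : Prop :=
  exists k : 'cV[R]_3, w = V *m k.

Lemma colspanZ V a w : colspan V w -> colspan V (a *: w).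
Proof. by move=> [k ->]; exists (a *: k); rewrite scalemxAr. Qed.

Definition ruling V : set (set 'cV[R]_3) :=
  [set l | exists X q, [/\ q != 0, colspan V (plucker X q) & l = line X q]].

(** The base point and the direction of a line are not unique, but another choice only rescales the
    Pluecker vector, so membership can be tested on any representation. *)
Lemma rulingE V X q : q != 0 -> ruling V (line X q) <-> colspan V (plucker X q).
Proof.
move=> q0; split => [|Vq]; last by exists X, q.
move=> [Y [r [r0 Vr e]]]; have [a a0 eq] := line_eq_direction r0 q0 (esym e).
have lX : line Y r X by rewrite -e; apply: line_base.
by rewrite eq pluckerZ (plucker_line lX); apply: colspanZ.
Qed.

Lemma ruling_lines V : ruling V `<=` @lines R.
Proof. by move=> l [X [q [q0 _ ->]]]; exists X, q. Qed.

Lemma ruling_through V l X : ruling V l -> l X ->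
  exists q, [/\ q != 0, colspan V (plucker X q) & l = line X q].
Proof.
move=> [Y [q [q0 Vq ->]]] lX; exists q; split=> //.
  by rewrite (plucker_line lX).
exact: line_rebase1.
Qed.

(** The last hypothesis makes all admissible directions at a point proportional, hence the line
    through it unique. *)
Lemma ruling_foliation Q V :
    (forall X q, q != 0 -> colspan V (plucker X q) -> Q X) ->
    (forall X, Q X -> exists2 q, q != 0 & colspan V (plucker X q)) ->
    (forall X q r, q != 0 -> r != 0 -> colspan V (plucker X q) ->
      colspan V (plucker X r) -> cross q r = 0) ->
  line_foliation Q (ruling V).
Proof.
move=> VQ QV VU; split; first exact: ruling_lines.
  move=> l Vl X lX; have [q [q0 Vq _]] := ruling_through Vl lX.
  exact: VQ q0 Vq.
move=> X /QV[q q0 Vq]; exists (line X q); split.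
  by split; [apply/rulingE | apply: line_base].
move=> l [Vl lX]; have [r [r0 Vr ->]] := ruling_through Vl lX.
have er := parallel_vectors q0 (VU _ _ _ q0 r0 Vq Vr).
rewrite {}er in r0 *; apply: line_rebase (line_base _ _).
by apply: contraNneq r0 => ->; rewrite scale0r.
Qed.

(** The sum is the Klein product of two Pluecker vectors; for two lines it vanishes exactly when
    they meet or are parallel. *)
Definition coplanar_spans V V' : Prop :=
  forall X q Y r, colspan V (plucker X q) -> colspan V' (plucker Y r) ->
    dot (cross X q) r + dot (cross Y r) q = 0.

(** Since direction and moment determine a line, this excludes distinct parallel lines in the
    ruling. *)
Definition direction_determines V : Prop :=
  forall X Y q, q != 0 -> colspan V (plucker X q) -> colspan V (plucker Y q) ->
    cross X q = cross Y q.

(** A line of the second ruling is coplanar with [g], so if it misses [g] it is parallel to [g]; the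
    second ruling has at most one line in that direction. *)
Lemma disjoint_line_unique V V' g h h' :
    coplanar_spans V V' -> direction_determines V' ->
    ruling V g -> ruling V' h -> ruling V' h' ->
    ~ (exists Z, g Z /\ h Z) -> ~ (exists Z, g Z /\ h' Z) -> h = h'.
Proof.
move=> cop dirV [X [q [q0 Vq ->]]].
have par l : ruling V' l -> ~ (exists Z, line X q Z /\ l Z) ->
    exists Y, colspan V' (plucker Y q) /\ l = line Y q.
  move=> [Y [r [r0 Vr ->]]] dis.
  have /parallel_vectors er : cross q r = 0.
    apply/eqP/negPn/negP => nqr.
    have [Z gZ lZ] := coplanar_lines_meet (cop _ _ _ _ Vq Vr) nqr.
    by apply: dis; exists Z.
  move: (er q0); set a := _ / _ => era.
  have a0 : a != 0 by apply: contraNneq r0 => a0; rewrite era a0 scale0r.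
  exists Y; split; last first.
    by rewrite era; symmetry; apply: line_rebase (line_base _ _).
  have -> : q = a^-1 *: r by rewrite era scalerA mulVf // scale1r.
  by rewrite pluckerZ; apply: colspanZ.
move=> Vh Vh' /(par _ Vh)[Y [VY ->]] /(par _ Vh')[Y' [VY' ->]].
exact: (eq_line_moment q0 (dirV _ _ _ q0 VY VY')).
Qed.

(** Every line in [Q] belongs to one of the two rulings. Once mixing them is excluded, a foliation
    is contained in a single ruling, and a foliation contained in another equals it, because each
    covers [Q] with one line through every point. *)
Lemma generating_families_spans Q V V' :
    Q !=set0 -> line_foliation Q (ruling V) -> line_foliation Q (ruling V') ->
    (forall X q, q != 0 -> line X q `<=` Q ->
      colspan V (plucker X q) \/ colspan V' (plucker X q)) ->
    (forall X q, q != 0 -> colspan V (plucker X q) -> ~ colspan V' (plucker X q)) ->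
    coplanar_spans V V' -> direction_determines V -> direction_determines V' ->
  generating_families Q (ruling V) (ruling V').
Proof.
move=> [X0 QX0] folV folV' all0 dis0 cop dirV dirV'.
have cop' : coplanar_spans V' V.
  by move=> X q Y r V'q Vr; rewrite addrC; apply: cop.
have all l : lines l -> l `<=` Q -> ruling V l \/ ruling V' l.
  move=> [X [q [q0 ->]]] /(all0 _ _ q0)[] ?; [left|right]; exact/rulingE.
have dis l : ruling V l -> ruling V' l -> False.
  by move=> [X [q [q0 Vq ->]]] /(rulingE _ _ q0); apply: dis0.
have folX F : line_foliation Q F -> forall X, Q X -> exists l, F l /\ l X.
  by move=> [_ _ folF] X /folF[l [? _]]; exists l.
have folU F : line_foliation Q F ->
    forall l h X, F l -> F h -> l X -> h X -> l = h.
  move=> [_ subF folF] l h X Fl Fh lX hX.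
  have [k [_ ku]] := folF X (subF _ Fl _ lX).
  by rewrite -(ku l) // -(ku h).
(* If F mixes the two rulings, then F = {g, h}; but the second-ruling line m
   through a point of g avoids h, so it would lie in g. *)
have mixed F : line_foliation Q F ->
    forall g h, F g -> F h -> ruling V g -> ruling V' h -> False.
  move=> folF g h Fg Fh Vg V'h.
  have nogh : ~ (exists Z, g Z /\ h Z).
    move=> [Z [gZ hZ]]; have e := folU _ folF _ _ _ Fg Fh gZ hZ.
    by apply: (dis g) => //; rewrite e.
  have only l : F l -> l = g \/ l = h.
    move=> Fl; case: (folF) => Fsub FQ _.
    have [Vl|V'l] := all l (Fsub _ Fl) (FQ _ Fl); [left|right].
      apply: (@disjoint_line_unique V' V h) => //.
        move=> [Z [hZ lZ]]; have e := folU _ folF _ _ _ Fh Fl hZ lZ.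
        by apply: (dis l) => //; rewrite -e.
      by move=> [Z [hZ gZ]]; apply: nogh; exists Z.
    apply: (@disjoint_line_unique V V' g) => //.
    move=> [Z [gZ lZ]]; have e := folU _ folF _ _ _ Fg Fl gZ lZ.
    by apply: (dis l) => //; rewrite -e.
  have [X [q [q0 Vq eg]]] := Vg.
  have gX : g X by rewrite eg; apply: line_base.
  have gQ : g `<=` Q by case: folV => _ + _; apply.
  have [m [V'm mX]] := folX _ folV' X (gQ _ gX).
  have [r [r0 _ em]] := ruling_through V'm mX.
  have mg Z : m Z -> g Z.
    move=> mZ; have QZ : Q Z by case: folV' => _ + _; apply; [exact: V'm|].
    have [l [Fl lZ]] := folX _ folF _ QZ.
    have [e|e] := only l Fl; first by rewrite -e.
    have mh : m = h by apply: (folU _ folV' _ _ Z) => //; rewrite -e.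
    by case: nogh; exists X; split; rewrite // -mh.
  have [mY neq] := line_next X r0; rewrite -em in mY.
  apply: (dis g) => //; suff <- : m = g by [].
  by apply: (lines_meet_once _ _ mX gX mY _ neq);
    [exact: ruling_lines V'm | exact: ruling_lines Vg | exact: mg].
have sub_eq F G : line_foliation Q F -> line_foliation Q G -> F `<=` G -> F = G.
  move=> folF folG FG; apply/seteqP; split=> // l Gl.
  have [X [q [q0 el]]] : lines l by case: folG => + _ _; apply.
  have lX : l X by rewrite el; apply: line_base.
  have QX : Q X by case: folG => _ + _; apply; [exact: Gl|].
  have [h [Fh hX]] := folX _ folF _ QX.
  by rewrite (folU _ folG l h X) //; apply: FG.
split.
  move=> e; have [l [Vl _]] := folX _ folV _ QX0.
  by apply: (dis l) => //; rewrite -e.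
move=> F; split=> [folF|[->|->//]] //.
have [l [Fl lX0]] := folX _ folF _ QX0.
case: (folF) => Fsub FQ _.
have [Vl|V'l] := all l (Fsub _ Fl) (FQ _ Fl); [left|right];
  apply: sub_eq => // h Fh.
  have [//|V'h] := all h (Fsub _ Fh) (FQ _ Fh).
  by have := mixed _ folF _ _ Fl Fh Vl V'h.
have [Vh|//] := all h (Fsub _ Fh) (FQ _ Fh).
by have := mixed _ folF _ _ Fh Fl Vh V'l.
Qed.

End Families.

(** * The model hyperboloid and paraboloid *)

Section Standard.
Variable R : realType.
Implicit Types (X Y Z p q r b : 'cV[R]_3) (A : 'M[R]_3) (V : 'M[R]_(3 + 3, 3)).
Implicit Types (s : R).

Definition rows_mx m n (rows : seq (seq R)) : 'M[R]_(m, n) :=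
  \matrix_(i, j) nth 0 (nth [::] rows i) j.

Definition lorentz : 'M[R]_3 :=
  rows_mx 3 3 [:: [:: 1; 0; 0]; [:: 0; 1; 0]; [:: 0; 0; -1]].

Definition hyperboloid : set 'cV[R]_3 :=
  [set X | X 0 0 ^+ 2 + X 1 0 ^+ 2 - X 2 0 ^+ 2 = 1].

Definition paraboloid : set 'cV[R]_3 :=
  [set X | X 2 0 = X 0 0 ^+ 2 - X 1 0 ^+ 2].

(** A graph of moments over directions. On it p.q = 0 reads s (q_0^2 + q_1^2 - q_2^2) = 0, so for
    nonzero [s] the directions of the lines fill the asymptotic cone; the sign of [s] selects the
    ruling. *)
Definition hyperboloid_span s : 'M[R]_(3 + 3, 3) :=
  col_mx (s *: lorentz) 1%:M.

(* The lines of the ruling with sign s have direction (1, s, 2 c) and moment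
   (- s c^2, - c^2, s c).  Writing these Pluecker vectors as u + c v + c^2 w, the
   columns are v, w - u and w + u, whose Gram matrix for s = 1 or -1 is
   4 s diag(1, 1, -1). *)
Definition paraboloid_span s : 'M[R]_(3 + 3, 3) :=
  col_mx (rows_mx 3 3 [:: [:: 0; - s; - s]; [:: 0; -1; -1]; [:: s; 0; 0]])
         (rows_mx 3 3 [:: [:: 0; -1; 1]; [:: 0; - s; s]; [:: 2; 0; 0]]).

Lemma span_hyperboloid s p q :
  colspan (hyperboloid_span s) (col_mx p q) <->
  [/\ p 0 0 = s * q 0 0, p 1 0 = s * q 1 0 & p 2 0 = - s * q 2 0].
Proof.
have E k : hyperboloid_span s *m k = col_mx (s *: (lorentz *m k)) k.
  by rewrite mul_col_mx mul1mx scalemxAl.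
split=> [[k]|[e0 e1 e2]]; last first.
  exists q; rewrite E; congr col_mx.
  by apply: cV3P; rewrite [RHS]mxE mulmxv3E !mxE /= ?e0 ?e1 ?e2; ring.
by rewrite E => /eq_col_mx[-> ->]; split; rewrite mxE mulmxv3E !mxE /=; ring.
Qed.

Lemma span_paraboloid s p q :
  colspan (paraboloid_span s) (col_mx p q) <->
  [/\ q 1 0 = s * q 0 0, p 0 0 = s * p 1 0 & p 2 0 = s * q 2 0 / 2].
Proof.
split=> [[k]|[e0 e1 e2]].
  rewrite mul_col_mx => /eq_col_mx[-> ->].
  by split; rewrite !mulmxv3E !mxE /=; field.
exists (vec3 (q 2 0 / 2) ((- p 1 0 - q 0 0) / 2) ((q 0 0 - p 1 0) / 2)).
rewrite mul_col_mx; congr col_mx; apply: cV3P;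
  by rewrite mulmxv3E !mxE /= ?e0 ?e1 ?e2; field.
Qed.

Lemma sign_neq0 s : s ^+ 2 = 1 -> s != 0.
Proof. by move=> e; rewrite -sqrf_eq0 e oner_neq0. Qed.

Lemma cV3_neq0P q : q 2 0 = 0 -> q 0 0 = 0 -> q 1 0 = 0 -> q = 0.
Proof. by move=> e2 e0 e1; apply: cV3P; rewrite mxE. Qed.

Lemma cross_collinear (a b : R) q : cross (a *: q) (b *: q) = 0.
Proof. by rewrite crossZl crossZr cross_self !scaler0. Qed.

(** The first two equations of [span_hyperboloid] are linear in q_0 and q_1, with determinant -(1 +
    X_2^2) when s^2 = 1; this is their solution for q_2 = 1 + X_2^2. *)
Definition hyperboloid_direction s X : 'cV[R]_3 :=
  vec3 (s * X 1 0 + X 0 0 * X 2 0) (X 1 0 * X 2 0 - s * X 0 0)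
    (1 + X 2 0 ^+ 2).

Lemma onep_sqr_neq0 (x : R) : 1 + x ^+ 2 != 0.
Proof. by rewrite lt0r_neq0 // ltr_pwDl ?sqr_ge0. Qed.

Lemma hyperboloid_span_direction s X q : s ^+ 2 = 1 ->
  colspan (hyperboloid_span s) (plucker X q) ->
  q = (q 2 0 / (1 + X 2 0 ^+ 2)) *: hyperboloid_direction s X.
Proof.
move=> s1 /span_hyperboloid; rewrite !crossE => -[e0 e1 e2].
have n0 := onep_sqr_neq0 (X 2 0).
apply: (scalerI n0); rewrite scalerA mulrCA mulfV // mulr1.
apply: cV3P; rewrite !mxE /=.
- have h0 := congr1 ( *%R s) e0; have h1 := congr1 ( *%R (X 2 0)) e1.
  have h2 := congr1 ( *%R (q 0 0)) s1.
  lra.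
- have h0 := congr1 ( *%R s) e1; have h1 := congr1 ( *%R (X 2 0)) e0.
  have h2 := congr1 ( *%R (q 1 0)) s1.
  lra.
- by rewrite mulrC.
Qed.

Lemma hyperboloid_direction_neq0 s X : hyperboloid_direction s X != 0.
Proof.
by apply: contra_neq (onep_sqr_neq0 (X 2 0)) => /colP/(_ 2); rewrite vec3E mxE.
Qed.

Lemma hyperboloid_span_q2 s X q : s ^+ 2 = 1 -> q != 0 ->
  colspan (hyperboloid_span s) (plucker X q) -> q 2 0 != 0.
Proof.
move=> s1 q0 /(hyperboloid_span_direction s1) e; apply: contra_neq q0 => q2.
by rewrite e q2 mul0r scale0r.
Qed.

Lemma hyperboloid_foliation s : s ^+ 2 = 1 ->
  line_foliation hyperboloid (ruling (hyperboloid_span s)).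
Proof.
move=> s1; have s0 := sign_neq0 s1; apply: ruling_foliation.
- move=> X q q0 Vq; have q2 := hyperboloid_span_q2 s1 q0 Vq.
  move/span_hyperboloid: Vq; rewrite !crossE => -[e0 e1 e2].
  (* [eX] and [eq] express that the moment is orthogonal to [X] and to [q]. *)
  have eX : X 0 0 * q 0 0 + X 1 0 * q 1 0 = X 2 0 * q 2 0.
    apply: (mulfI s0).
    have h0 := congr1 ( *%R (X 0 0)) e0; have h1 := congr1 ( *%R (X 1 0)) e1.
    have h2 := congr1 ( *%R (X 2 0)) e2.
    lra.
  have eq : q 0 0 ^+ 2 + q 1 0 ^+ 2 = q 2 0 ^+ 2.
    apply: (mulfI s0).
    have h0 := congr1 ( *%R (q 0 0)) e0; have h1 := congr1 ( *%R (q 1 0)) e1.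
    have h2 := congr1 ( *%R (q 2 0)) e2.
    lra.
  apply: (mulIf (expf_neq0 2 q2)).
  (* Lagrange's identity for the first two coordinates of [X] and [q], after [eq] has replaced
     q_2^2. *)
  have -> : (X 0 0 ^+ 2 + X 1 0 ^+ 2 - X 2 0 ^+ 2) * q 2 0 ^+ 2 =
      (X 0 0 * q 1 0 - X 1 0 * q 0 0) ^+ 2
      + (X 0 0 * q 0 0 + X 1 0 * q 1 0) ^+ 2 - (X 2 0 * q 2 0) ^+ 2.
    rewrite mulrBl -{1}eq; ring.
  by rewrite eX e2 addrK exprMn sqrrN s1.
- move=> X QX; exists (hyperboloid_direction s X).
    exact: hyperboloid_direction_neq0.
  apply/span_hyperboloid; rewrite !crossE !vec3E.
  move: QX; rewrite /hyperboloid /= => QX.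
  have h0 := congr1 ( *%R (X 0 0)) s1; have h1 := congr1 ( *%R (X 1 0)) s1.
  have h2 := congr1 ( *%R s) QX.
  split; lra.
- move=> X q r q0 r0 /(hyperboloid_span_direction s1) ->.
  by move=> /(hyperboloid_span_direction s1) ->; apply: cross_collinear.
Qed.

Lemma hyperboloid_generating s : s ^+ 2 = 1 ->
  generating_families hyperboloid (ruling (hyperboloid_span s))
    (ruling (hyperboloid_span (- s))).
Proof.
move=> s1; have s0 := sign_neq0 s1.
have s1' : (- s) ^+ 2 = 1 by rewrite sqrrN.
have dir t : direction_determines (hyperboloid_span t).
  move=> X Y q _ /span_hyperboloid[e0 e1 e2] /span_hyperboloid[f0 f1 f2].
  by apply: cV3P; rewrite ?e0 ?e1 ?e2 ?f0 ?f1 ?f2.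
apply: generating_families_spans => //; try exact: hyperboloid_foliation.
- by exists (vec3 1 0 0); rewrite /hyperboloid /= !vec3E; ring.
- move=> X q q0 sub; have QX : hyperboloid X by exact/sub/line_base.
  have Qt t : hyperboloid (X + t *: q) by apply: sub; exists t.
  (* The values at t = 0, 1, -1 separate the linear and the quadratic coefficient of the equation in
     t. *)
  move: QX (Qt 1) (Qt (-1)); rewrite /hyperboloid /= !mxE => QX Q1 Qm1.
  have eq : q 0 0 ^+ 2 + q 1 0 ^+ 2 = q 2 0 ^+ 2 by lra.
  have eX : X 0 0 * q 0 0 + X 1 0 * q 1 0 = X 2 0 * q 2 0 by lra.
  have q2 : q 2 0 != 0.
    apply: contra_neq q0 => q2; rewrite q2 in eq.
    by apply: cV3_neq0P => //; apply/eqP; rewrite -sqrf_eq0; apply/eqP; nra.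
  (* The third coordinate of the moment is q_2 up to sign, again by Lagrange's identity; the sign
     decides the ruling. *)
  have /eqP : (X 0 0 * q 1 0 - X 1 0 * q 0 0) ^+ 2 = q 2 0 ^+ 2.
    apply: (addIr ((X 0 0 * q 0 0 + X 1 0 * q 1 0) ^+ 2)).
    have -> : (X 0 0 * q 1 0 - X 1 0 * q 0 0) ^+ 2 +
      (X 0 0 * q 0 0 + X 1 0 * q 1 0) ^+ 2 =
      (X 0 0 ^+ 2 + X 1 0 ^+ 2) * (q 0 0 ^+ 2 + q 1 0 ^+ 2) by ring.
    rewrite eq eX; have -> : X 0 0 ^+ 2 + X 1 0 ^+ 2 = 1 + X 2 0 ^+ 2 by lra.
    by ring.
  have key t : t ^+ 2 = 1 -> X 0 0 * q 1 0 - X 1 0 * q 0 0 = - t * q 2 0 ->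
      colspan (hyperboloid_span t) (plucker X q).
    move=> t1 e; apply/span_hyperboloid; rewrite !crossE; split=> //.
    - apply: (mulfI q2); have h0 := congr1 ( *%R (X 1 0)) eq.
      have h1 := congr1 ( *%R (q 1 0)) eX; have h2 := congr1 ( *%R (q 0 0)) e.
      lra.
    - apply: (mulfI q2); have h0 := congr1 ( *%R (X 0 0)) eq.
      have h1 := congr1 ( *%R (q 0 0)) eX; have h2 := congr1 ( *%R (q 1 0)) e.
      lra.
  have st : s = 1 \/ s = -1.
    by move/eqP: s1; rewrite sqrf_eq1 => /orP[]/eqP; [left | right].
  rewrite eqf_sqr => /orP[]/eqP e; case: st => es.
  + by right; apply: key => //; rewrite e es; ring.
  + by left; apply: key => //; rewrite e es; ring.
  + by left; apply: key => //; rewrite e es; ring.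
  + by right; apply: key => //; rewrite e es; ring.
- move=> X q q0 Vq /span_hyperboloid[_ _ f2].
  have q2 := hyperboloid_span_q2 s1 q0 Vq.
  case/span_hyperboloid: Vq => _ _ e2; move: f2; rewrite e2 opprK => /(mulIf q2).
  move=> f2; move: s0; rewrite (_ : s = 0) ?eqxx //; lra.
- move=> X q Y r /span_hyperboloid[e0 e1 e2] /span_hyperboloid[f0 f1 f2].
  by rewrite /dot e0 e1 e2 f0 f1 f2; ring.
Qed.

(** The third coordinate is the derivative of x^2 - y^2 at [X] along (1, s). *)
Definition paraboloid_direction s X : 'cV[R]_3 :=
  vec3 1 s (2 * (X 0 0 - s * X 1 0)).

Lemma paraboloid_span_direction s X q : s ^+ 2 = 1 ->
  colspan (paraboloid_span s) (plucker X q) ->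
  q = q 0 0 *: paraboloid_direction s X.
Proof.
move=> s1 /span_paraboloid; rewrite !crossE => -[e0 e1 e2].
apply: cV3P; rewrite !mxE /= ?mulr1 // 1?mulrC //.
apply: (mulfI (sign_neq0 s1)).
have h1 := congr1 ( *%R (X 0 0)) e0.
have h2 := congr1 ( *%R (q 0 0 * X 1 0)) s1.
lra.
Qed.

Lemma paraboloid_span_q0 s X q : s ^+ 2 = 1 -> q != 0 ->
  colspan (paraboloid_span s) (plucker X q) -> q 0 0 != 0.
Proof.
move=> s1 q0 /(paraboloid_span_direction s1) e; apply: contra_neq q0 => e0.
by rewrite e e0 scale0r.
Qed.

Lemma paraboloid_colspan s X q : s ^+ 2 = 1 -> paraboloid X ->
  q 1 0 = s * q 0 0 -> q 2 0 = 2 * (X 0 0 * q 0 0 - X 1 0 * q 1 0) ->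
  colspan (paraboloid_span s) (plucker X q).
Proof.
rewrite /paraboloid /= => s1 QX e1 e2.
apply/span_paraboloid; rewrite !crossE e2 e1 QX; split=> //.
  have h1 := congr1 ( *%R (q 0 0 * X 0 0 * X 1 0)) s1.
  have h2 := congr1 ( *%R (q 0 0 * X 1 0 ^+ 2 * s)) s1.
  lra.
have h1 := congr1 ( *%R (q 0 0 * X 1 0)) s1.
lra.
Qed.

Lemma paraboloid_foliation s : s ^+ 2 = 1 ->
  line_foliation paraboloid (ruling (paraboloid_span s)).
Proof.
move=> s1; have s0 := sign_neq0 s1; apply: ruling_foliation.
- move=> X q qn0 Vq; have q0 := paraboloid_span_q0 s1 qn0 Vq.
  have := paraboloid_span_direction s1 Vq => /colP/(_ 2); rewrite mxE vec3E => e2.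
  move/span_paraboloid: Vq; rewrite !crossE => -[e1 e0 _].
  apply: (mulfI q0); apply: (mulfI s0); rewrite e1 e2 in e0.
  have h1 := congr1 ( *%R (q 0 0 * X 0 0 * X 1 0)) s1.
  have h2 := congr1 ( *%R (q 0 0 * X 1 0 ^+ 2 * s)) s1.
  lra.
- move=> X QX; exists (paraboloid_direction s X).
    by apply: contra_neq (oner_neq0 R) => /colP/(_ 0); rewrite vec3E mxE.
  apply: paraboloid_colspan => //; rewrite !vec3E ?mulr1 //.
  by ring.
- move=> X q r q0 r0 /(paraboloid_span_direction s1) ->.
  by move=> /(paraboloid_span_direction s1) ->; apply: cross_collinear.
Qed.

Lemma paraboloid_generating s : s ^+ 2 = 1 ->
  generating_families paraboloid (ruling (paraboloid_span s))
    (ruling (paraboloid_span (- s))).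
Proof.
move=> s1; have s0 := sign_neq0 s1.
have s1' : (- s) ^+ 2 = 1 by rewrite sqrrN.
have dir t : t ^+ 2 = 1 -> direction_determines (paraboloid_span t).
  move=> t1 X Y q qn0 VX VY; have q0 := paraboloid_span_q0 t1 qn0 VX.
  (* Unlike for the hyperboloid, the span is not a graph over the directions. The moment coordinate
     that its equations leave free is fixed by p.q = 0, where its coefficient is 2 t q_0. *)
  have orth Z : dot (cross Z q) q = 0 by rewrite /dot !crossE; ring.
  move: VX VY (orth X) (orth Y); rewrite /dot.
  move=> /span_paraboloid[e e0 e2] /span_paraboloid[f f0 f2].
  rewrite e0 f0 e2 f2 e => oX oY.
  have e1 : cross X q 1 0 = cross Y q 1 0.
    by apply: (mulfI q0); apply: (mulfI (sign_neq0 t1)); lra.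
  by apply: cV3P; rewrite ?e0 ?e2 ?f0 ?f2 ?e1.
apply: generating_families_spans => //;
  try exact: paraboloid_foliation; try exact: dir.
- by exists 0; rewrite /paraboloid /= !mxE; ring.
- move=> X q q0 sub; have QX : paraboloid X by exact/sub/line_base.
  have Qt t : paraboloid (X + t *: q) by apply: sub; exists t.
  move: (QX) (Qt 1) (Qt (-1)); rewrite /paraboloid /= !mxE => eX Q1 Qm1.
  have eq : q 0 0 ^+ 2 = q 1 0 ^+ 2 by lra.
  have e2 : q 2 0 = 2 * (X 0 0 * q 0 0 - X 1 0 * q 1 0) by lra.
  have : q 1 0 = s * q 0 0 \/ q 1 0 = - s * q 0 0.
    have /eqP : q 1 0 ^+ 2 = (s * q 0 0) ^+ 2 by rewrite exprMn s1 mul1r eq.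
    by rewrite mulNr eqf_sqr => /orP[]/eqP; [left | right].
  by case=> e; [left | right]; apply: paraboloid_colspan.
- move=> X q qn0 Vq /span_paraboloid[f _ _].
  have q0 := paraboloid_span_q0 s1 qn0 Vq.
  case/span_paraboloid: Vq => e _ _; move: f; rewrite e => /(mulIf q0).
  move=> f; move: s0; rewrite (_ : s = 0) ?eqxx //; lra.
- move=> X q Y r /span_paraboloid[e1 e0 e2] /span_paraboloid[f1 f0 f2].
  by rewrite /dot e0 e1 e2 f0 f1 f2; ring.
Qed.

End Standard.

(** * Affine maps acting on rulings *)

Section Affine.
Variable R : realType.
Implicit Types (X Y Z p q r b : 'cV[R]_3) (A : 'M[R]_3) (V : 'M[R]_(3 + 3, 3)).
Implicit Types (Q g h l : set 'cV[R]_3) (F G : set (set 'cV[R]_3)).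

Lemma affine_imageK A b Q : A \in unitmx ->
  affine_image (invmx A) (- (invmx A *m b)) (affine_image A b Q) = Q.
Proof.
move=> uA; have K X : invmx A *m (A *m X + b) - invmx A *m b = X.
  by rewrite mulmxDr mulKmx // addrK.
apply/seteqP; split=> [_ [_ [X QX <-] <-]|X QX]; first by rewrite K.
by exists (A *m X + b); [exists X | rewrite K].
Qed.

Lemma affine_imageKV A b Q : A \in unitmx ->
  affine_image A b (affine_image (invmx A) (- (invmx A *m b)) Q) = Q.
Proof.
move=> uA; have uV : invmx A \in unitmx by rewrite unitmx_inv.
have := affine_imageK (- (invmx A *m b)) Q uV.
by rewrite invmxK mulmxN opprK mulKVmx.
Qed.

Lemma affine_image_line A b X q :
  affine_image A b (line X q) = line (A *m X + b) (A *m q).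
Proof.
have E t : A *m (X + t *: q) + b = A *m X + b + t *: (A *m q).
  by rewrite mulmxDr -scalemxAr addrAC.
apply/seteqP; split=> [_ [_ [t ->] <-]|_ [t ->]]; first by exists t.
by exists (X + t *: q); [exists t | rewrite E].
Qed.

Lemma affine_inj A b X Y : A \in unitmx -> A *m X + b = A *m Y + b -> X = Y.
Proof. by move=> uA /addIr /(can_inj (mulKmx uA)). Qed.

Lemma affine_foliation A b Q F : A \in unitmx -> line_foliation Q F ->
  line_foliation (affine_image A b Q) (affine_image A b @` F).
Proof.
move=> uA [FL FQ FU]; split.
- move=> _ [l Fl <-]; have [X [q [q0 ->]]] := FL _ Fl.
  exists (A *m X + b), (A *m q); split; last exact: affine_image_line.
  by apply: contra_neq q0 => e; rewrite -(mulKmx uA q) e mulmx0.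
- move=> _ [l Fl <-] _ [X lX <-]; exists X => //.
  exact: FQ lX.
- move=> _ [X QX <-]; have [l [[Fl lX] lU]] := FU _ QX.
  exists (affine_image A b l); split.
    by split; [exists l | exists X].
  move=> _ [[h Fh <-] [Y hY /(affine_inj uA) e]].
  by rewrite (lU h) //; split; rewrite // -e.
Qed.

Lemma affine_image_imageK A b F : A \in unitmx ->
  affine_image A b @`
    (affine_image (invmx A) (- (invmx A *m b)) @` F) = F.
Proof.
move=> uA; apply/seteqP; split=> [_ [_ [l Fl <-] <-]|l Fl].
  by rewrite affine_imageKV.
exists (affine_image (invmx A) (- (invmx A *m b)) l); first by exists l.
exact: affine_imageKV.
Qed.

Lemma affine_generating A b Q G G' : A \in unitmx ->
  generating_families Q G G' ->
  generating_families (affine_image A b Q) (affine_image A b @` G)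
    (affine_image A b @` G').
Proof.
move=> uA [neq gen]; have uV : invmx A \in unitmx by rewrite unitmx_inv.
have inj F1 F2 : affine_image A b @` F1 = affine_image A b @` F2 -> F1 = F2.
  move=> e; have := affine_image_imageK (- (invmx A *m b)) F1 uV.
  rewrite invmxK mulmxN opprK mulKVmx // e => <-.
  have := affine_image_imageK (- (invmx A *m b)) F2 uV.
  by rewrite invmxK mulmxN opprK mulKVmx.
split; first by move=> /inj.
move=> F; split=> [folF|[]->].
- have := affine_foliation (- (invmx A *m b)) uV folF.
  rewrite affine_imageK // => /gen[] e; [left|right];
    by rewrite -e affine_image_imageK.
- by apply: affine_foliation => //; apply/gen; left.
- by apply: affine_foliation => //; apply/gen; right.
Qed.

(** * Affine maps as similarities of the Klein form *)

Definition klein_form : 'M[R]_(3 + 3) := block_mx 0 1%:M 1%:M 0.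

(** The blocks are read off from (A X + b) x A q = cof A (X x q) + b x A q. *)
Definition affine_plucker A b : 'M[R]_(3 + 3) :=
  block_mx (cof A) (cross_mx b *m A) 0 A.

Lemma affine_plucker_col A b p q :
  affine_plucker A b *m col_mx p q =
  col_mx (cof A *m p + cross b (A *m q)) (A *m q).
Proof. by rewrite mul_block_col mul0mx add0r -mulmxA mul_cross_mx. Qed.

Lemma affine_plucker_line A b X q : A \in unitmx ->
  affine_plucker A b *m plucker X q = plucker (A *m X + b) (A *m q).
Proof.
move=> uA; rewrite affine_plucker_col -cross_mulmx //; congr col_mx.
by apply: cV3P; rewrite !(crossE, mxE); ring.
Qed.

(** The factor arises from (cof A)^T A = det A; the translation contributes only A^T (C + C^T) A
    with C = [cross_mx b], which vanishes because C is antisymmetric. *)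
Lemma affine_plucker_gram A b : A \in unitmx ->
  (affine_plucker A b)^T *m klein_form *m affine_plucker A b =
  \det A *: klein_form.
Proof.
move=> uA; rewrite /affine_plucker /klein_form tr_block_mx !mulmx_block.
have E : (cof A)^T *m A = (\det A)%:M.
  have -> : (cof A)^T = \det A *: invmx A by apply/matrixP => i j; rewrite !mxE.
  by rewrite -scalemxAl mulVmx // scale_scalar_mx mulr1.
have E' : A^T *m cof A = (\det A)%:M.
  by rewrite -[LHS]trmxK trmx_mul trmxK E tr_scalar_mx.
rewrite !(mulmx0, mul0mx, mulmx1, mul1mx, trmx0, addr0, add0r) E E'.
rewrite scale_block_mx !scaler0 !scale_scalar_mx mulr1; congr block_mx.
rewrite trmx_mul tr_cross_mx mulmxN mulNmx -mulmxA; exact: addrN.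
Qed.

Lemma gram_unitmx m (M B C : 'M[R]_m) :
  M^T *m B *m M = C -> C \in unitmx -> M \in unitmx.
Proof. by move=> <-; rewrite unitmx_mul => /andP[]. Qed.

Lemma klein_form_sqr : klein_form *m klein_form = 1%:M.
Proof.
rewrite mulmx_block !(mulmx0, mul0mx, mulmx1, mul1mx, addr0, add0r).
by rewrite -scalar_mx_block.
Qed.

Lemma klein_form_unit : klein_form \in unitmx.
Proof. by have [] := mulmx1_unit klein_form_sqr. Qed.

Lemma affine_plucker_unit A b : A \in unitmx -> affine_plucker A b \in unitmx.
Proof.
move=> uA; apply: (gram_unitmx (affine_plucker_gram b uA)).
by rewrite unitmxZ ?klein_form_unit // -unitmxE.
Qed.

Lemma affine_ruling A b V : A \in unitmx ->
  affine_image A b @` ruling V = ruling (affine_plucker A b *m V).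
Proof.
move=> uA; apply/seteqP; split=> [_ [_ [X [q [q0 [k Vk] ->]]] <-]|].
  rewrite affine_image_line; exists (A *m X + b), (A *m q); split=> //.
    by apply: contra_neq q0 => e; rewrite -(mulKmx uA q) e mulmx0.
  by exists k; rewrite -affine_plucker_line // Vk mulmxA.
move=> _ [Y [r [r0 [k Vk] ->]]].
set X := invmx A *m (Y - b); set q := invmx A *m r.
have eY : A *m X + b = Y by rewrite mulKVmx // subrK.
have er : A *m q = r by rewrite mulKVmx.
exists (line X q); last by rewrite affine_image_line eY er.
exists X, q; split=> //.
  by apply: contra_neq r0 => q0; rewrite -er q0 mulmx0.
exists k; apply: (can_inj (mulKmx (affine_plucker_unit b uA))).
by rewrite affine_plucker_line // eY er Vk mulmxA.
Qed.

Lemma ruling_mulmx V (U : 'M[R]_3) : U \in unitmx -> ruling (V *m U) = ruling V.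
Proof.
move=> uU; apply/seteqP; split=> _ [X [q [q0 [k e] ->]]];
  exists X, q; split=> //.
  by exists (U *m k); rewrite e mulmxA.
by exists (invmx U *m k); rewrite e -mulmxA mulKVmx.
Qed.

End Affine.

(** * Pairs of conjugate 3-planes *)

Section NormalForm.
Variable R : realType.
Implicit Types (X Y Z p q r b : 'cV[R]_3) (A P U : 'M[R]_3).
Implicit Types (V W : 'M[R]_(3 + 3, 3)).
Implicit Types (Q g h l : set 'cV[R]_3) (F G : set (set 'cV[R]_3)).
Implicit Types (N : 'M[R]_(3 + 3)) (c s : R).

Notation D := (lorentz R).
Notation H := (klein_form R).

(** The first and the last three columns of [N] span the two orthogonal 3-planes. The factor [c] may
    have either sign: affine maps multiply it by their determinant, and exchanging the planes
    negates it. *)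
Definition conjugate_gram c N : Prop :=
  N^T *m H *m N = c *: block_mx D 0 0 (- D).

Lemma klein_form_col_mx P A P' A' :
  (col_mx P A)^T *m H *m col_mx P' A' = P^T *m A' + A^T *m P'.
Proof.
rewrite tr_col_mx /klein_form mul_row_block.
by rewrite !(mulmx0, mulmx1, addr0, add0r) mul_row_col addrC.
Qed.

Lemma klein_form_sym V W : W^T *m H *m V = (V^T *m H *m W)^T.
Proof.
by rewrite !trmx_mul trmxK tr_block_mx !trmx0 !trmx1 mulmxA.
Qed.

Lemma conjugate_gramE c V W :
  conjugate_gram c (row_mx V W) <->
  [/\ V^T *m H *m V = c *: D, V^T *m H *m W = 0 & W^T *m H *m W = - c *: D].
Proof.
rewrite /conjugate_gram tr_row_mx mul_col_mx mul_col_row scale_block_mx.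
rewrite !scaler0 scalerN -scaleNr.
split=> [/eq_block_mx[-> -> _ ->] //|[-> VW ->]].
by rewrite VW klein_form_sym VW trmx0.
Qed.

Lemma conjugate_gram_swap c V W :
  conjugate_gram c (row_mx V W) -> conjugate_gram (- c) (row_mx W V).
Proof.
move=> /conjugate_gramE[eV VW eW]; apply/conjugate_gramE.
by split; rewrite ?opprK // klein_form_sym VW trmx0.
Qed.

Lemma affine_conjugate_gram A b c N : A \in unitmx -> conjugate_gram c N ->
  conjugate_gram (\det A * c) (affine_plucker A b *m N).
Proof.
move=> uA; rewrite /conjugate_gram => eN.
have -> : (affine_plucker A b *m N)^T *m H *m (affine_plucker A b *m N) =
    N^T *m ((affine_plucker A b)^T *m H *m affine_plucker A b) *m N.
  by rewrite trmx_mul !mulmxA.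
by rewrite affine_plucker_gram // -scalemxAr -scalemxAl eN scalerA.
Qed.

Lemma lorentz_sqr : D *m D = 1%:M.
Proof.
by apply/matrixP; apply: ord3P; apply: ord3P; rewrite !mxE sum3E !mxE /=; ring.
Qed.

Lemma lorentz_unit : D \in unitmx.
Proof. by have [] := mulmx1_unit lorentz_sqr. Qed.

Lemma signature_unit : block_mx D 0 0 (- D) \in unitmx.
Proof.
suff /mulmx1_unit[] : block_mx D 0 0 (- D) *m block_mx D 0 0 (- D) = 1%:M by [].
rewrite mulmx_block !(mulmx0, mul0mx, addr0, add0r) mulmxN mulNmx opprK.
by rewrite lorentz_sqr -scalar_mx_block.
Qed.

Lemma conjugate_gram_unit c N : c != 0 -> conjugate_gram c N -> N \in unitmx.
Proof.
by move=> c0 /gram_unitmx; apply; rewrite unitmxZ ?unitfE ?signature_unit.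
Qed.

Lemma hyperboloid_gram :
  conjugate_gram 2 (row_mx (hyperboloid_span 1) (hyperboloid_span (-1 : R))).
Proof.
apply/conjugate_gramE; rewrite /hyperboloid_span !klein_form_col_mx.
by split; apply/matrixP; apply: ord3P; apply: ord3P;
  rewrite !mxE !sum3E !mxE /=; ring.
Qed.

Lemma paraboloid_gram :
  conjugate_gram 4 (row_mx (paraboloid_span 1) (paraboloid_span (-1 : R))).
Proof.
apply/conjugate_gramE; rewrite /paraboloid_span !klein_form_col_mx.
by split; apply/matrixP; apply: ord3P; apply: ord3P;
  rewrite !mxE !sum3E !mxE /=; ring.
Qed.

(** The second plane is the orthogonal complement of the first, so matching the first planes matches
    the second ones too. Nondegenerate Gram matrices make both changes of basis invertible. *)
Lemma eq_ruling_of_factor c c' V W V' W' U : c != 0 -> c' != 0 ->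
    conjugate_gram c (row_mx V W) -> conjugate_gram c' (row_mx V' W') ->
    V *m U = V' ->
  ruling V = ruling V' /\ ruling W = ruling W'.
Proof.
move=> c0 c0' gN gN' eU; have uN := conjugate_gram_unit c0 gN.
case/conjugate_gramE: gN => eV eVW eW; case/conjugate_gramE: gN' => eV' eVW' eW'.
have uD : c *: D \in unitmx by rewrite unitmxZ ?unitfE ?lorentz_unit.
have uD' : c' *: D \in unitmx by rewrite unitmxZ ?unitfE ?lorentz_unit.
have uU : U \in unitmx.
  apply: (@gram_unitmx _ _ _ (c *: D) (c' *: D)) => //.
  by rewrite -eV' -eU trmx_mul -eV !mulmxA.
set k := invmx (row_mx V W) *m W'.
have ek : W' = V *m usubmx k + W *m dsubmx k.
  by rewrite -mul_row_col vsubmxK mulKVmx.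
(* The component of [W'] along [V] vanishes: [W'] is orthogonal to V' = V U, and the form is
   nondegenerate on [V]. *)
have x0 : usubmx k = 0.
  apply: (can_inj (mulKmx uD)); rewrite mulmx0 -eV.
  have uUt : U^T \in unitmx by rewrite unitmx_tr.
  apply: (can_inj (mulKmx uUt)); rewrite mulmx0 -eVW' -eU ek.
  have -> : (V *m U)^T *m H *m (V *m usubmx k + W *m dsubmx k) =
      U^T *m (V^T *m H *m V *m usubmx k + V^T *m H *m W *m dsubmx k).
    by rewrite trmx_mul !mulmxDr !mulmxA.
  by rewrite eVW mul0mx addr0.
have eW2 : W' = W *m dsubmx k by rewrite {1}ek x0 mulmx0 add0r.
have uk : dsubmx k \in unitmx.
  apply: (@gram_unitmx _ _ _ (- c *: D) (- c' *: D)).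
    by rewrite -eW' eW2 trmx_mul -eW !mulmxA.
  by rewrite scaleNr -scaleN1r unitmxZ // unitrN1.
by rewrite -eU eW2 !ruling_mulmx.
Qed.

End NormalForm.

(** * Affine classification *)

Section Classification.
Variable R : realType.
Implicit Types (X Y Z p q r b k : 'cV[R]_3) (A P U : 'M[R]_3).
Implicit Types (V W : 'M[R]_(3 + 3, 3)).
Implicit Types (Q g h l : set 'cV[R]_3) (F G : set (set 'cV[R]_3)).
Implicit Types (N : 'M[R]_(3 + 3)) (c s : R).

Notation D := (lorentz R).
Notation H := (klein_form R).

Lemma antisym_cross_mx (M : 'M[R]_3) : M^T = - M -> exists b, M = cross_mx b.
Proof.
move=> /matrixP asym; exists (vec3 (M 2 1) (M 0 2) (M 1 0)).
have a i j : M i j = - M j i by have := asym j i; rewrite !mxE.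
have d i : M i i = 0 by have := a i i; lra.
apply/matrixP; apply: ord3P; apply: ord3P; rewrite !mxE /= ?d //; exact: a.
Qed.

(** The plane is the graph of K = P A^-1. By hypothesis the symmetric part of K is (c / 2) A^-T D
    A^-1, which a linear map brings to D; the antisymmetric part is a cross product with some [b]
    and is removed by a translation. *)
Lemma hyperboloid_factor c P A : P^T *m A + A^T *m P = c *: D ->
    c != 0 -> A \in unitmx ->
  exists B b U, B \in unitmx /\
    col_mx P A *m U = affine_plucker B b *m hyperboloid_span 1.
Proof.
move=> e c0 uA; have d0 : \det A != 0 by rewrite -unitfE -unitmxE.
(* t makes \det (t A) (t A)^-T D (t A)^-1 equal to the symmetric part of K. *)
set t := c / 2 / \det A.
have t0 : t != 0 by rewrite !mulf_neq0 ?invr_neq0 // pnatr_eq0.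
have uAt : A^T \in unitmx by rewrite unitmx_tr.
set K := P *m invmx A.
have [b eb] : exists b, 2^-1 *: (K - K^T) = cross_mx b.
  apply: antisym_cross_mx; apply/matrixP => i j.
  by rewrite !mxE; ring.
exists (t *: A), b, t%:M; split; first by rewrite unitmxZ ?unitfE.
rewrite /affine_plucker /hyperboloid_span mul_block_col mul_col_mx.
rewrite !mul_mx_scalar !scale1r mul0mx add0r; congr col_mx.
rewrite /cof detZ invmxZ ?unitmxZ ?unitfE //.
apply: (can_inj (mulKmx uAt)).
have -> : (t^-1 *: invmx A)^T = t^-1 *: (invmx A)^T.
  by apply/matrixP => i j; rewrite !mxE.
rewrite mulmxDr -!scalemxAl -!scalemxAr mulmxA -trmx_mul mulVmx // trmx1 mul1mx.
rewrite -eb -!scalemxAl -!scalemxAr mulmxA mulmxBr mulmxBl /K mulmxA mulmxKV //.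
rewrite trmx_mul mulmxA -trmx_mul mulVmx // trmx1 mul1mx.
have -> : t ^+ 3 * \det A *: (t^-1 *: D) = t *: (2^-1 *: (c *: D)).
  rewrite !scalerA; congr (_ *: _); rewrite /t; field.
  by rewrite d0 c0.
rewrite -e -!scalerDr; congr (_ *: _).
move: (A^T *m P) (P^T *m A) => M M'.
by apply/matrixP => i j; rewrite !mxE; field.
Qed.

(** The witness is the foot of the perpendicular from the origin. *)
Lemma line_of_moment p q : q != 0 -> dot p q = 0 -> exists X, cross X q = p.
Proof.
rewrite -dot_eq0 => q0 pq; exists ((dot q q)^-1 *: cross q p).
apply: (scalerI q0).
rewrite crossZl scalerA mulfV // scale1r cross_cross.
by rewrite pq scale0r subr0.
Qed.

(** The data describe two coplanar lines that are not parallel; their common point yields both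
    moments. *)
Lemma point_of_moments p q p' q' : dot p q = 0 -> dot p' q' = 0 ->
    dot p q' + dot p' q = 0 -> cross q q' != 0 ->
  exists b, cross b q = p /\ cross b q' = p'.
Proof.
move=> pq pq' pp n0.
have q0 : q != 0.
  by apply: contra_neq n0 => ->; rewrite cross0v.
have q0' : q' != 0.
  by apply: contra_neq n0 => ->; rewrite crossv0.
have [X eX] := line_of_moment q0 pq; have [Y eY] := line_of_moment q0' pq'.
have cop : dot (cross X q) q' + dot (cross Y q') q = 0 by rewrite eX eY.
have [Z ZX ZY] := coplanar_lines_meet cop n0.
by exists Z; rewrite (cross_line ZX) (cross_line ZY).
Qed.

Lemma colspan_factor V V' : (forall j, colspan V (col j V')) ->
  exists U, V *m U = V'.
Proof.
move=> h; have [f ef] := boolp.choice h; exists (\matrix_(i, j) f j i 0).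
apply/matrixP => i j; have /colP/(_ i) := ef j; rewrite !mxE => ->.
by apply: eq_bigr => l _; rewrite mxE.
Qed.

(** A kernel vector of [A] is a line at infinity of the plane. It is completed to a frame with the
    Gram relations of the frame of the model; the linear part [B] comes from the moment of this line
    and the directions of the other two vectors, and the translation from the moments of those
    two. *)
Lemma paraboloid_factor c P A : P^T *m A + A^T *m P = c *: D ->
    c != 0 -> A \notin unitmx ->
  exists B b U, B \in unitmx /\
    col_mx P A *m U = affine_plucker B b *m paraboloid_span 1.
Proof.
move=> e c0 nuA.
have [k k0 Ak] : exists2 k : 'cV[R]_3, k != 0 & A *m k = 0.
  move: nuA; rewrite -unitmx_tr unitmxE unitfE negbK => /det0P[u u0 uA].
  exists u^T; first by rewrite trmx_eq0.
  by rewrite -[LHS]trmxK trmx_mul trmxK uA trmx0.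
have gram x y : dot (P *m x) (A *m y) + dot (A *m x) (P *m y) =
    c * (x 0 0 * y 0 0 + x 1 0 * y 1 0 - x 2 0 * y 2 0).
  have := congr1 (fun M : 'M[R]_3 => (x^T *m (M *m y)) 0 0) e.
  rewrite !dotE !trmx_mul -!mulmxA -[in RHS]scalemxAl => h.
  transitivity ((x^T *m (c *: (D *m y))) 0 0).
    by rewrite -h mulmxDl mulmxDr !mulmxA [RHS]mxE.
  by rewrite [LHS]mxE sum3E !(mulmxv3E, mxE) /=; ring.
(* k spans the null line of V at infinity; kf is a second null vector, and kh is
   orthogonal to both. *)
set kf := vec3 (k 0 0) (k 1 0) (- k 2 0).
set kh := vec3 (- k 1 0) (k 0 0) 0.
set a := P *m k; set pf := P *m kf; set qf := A *m kf.
set ph := P *m kh; set qh := A *m kh.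
have kk : k 0 0 ^+ 2 + k 1 0 ^+ 2 - k 2 0 ^+ 2 = 0.
  apply: (mulfI c0); rewrite mulr0; have := gram k k.
  by rewrite Ak /dot !mxE; lra.
have pos : k 0 0 ^+ 2 + k 1 0 ^+ 2 != 0.
  apply: contra_neq k0 => z.
  have z0 : k 0 0 = 0 by apply/eqP; rewrite -sqrf_eq0; apply/eqP; nra.
  have z1 : k 1 0 = 0 by apply/eqP; rewrite -sqrf_eq0; apply/eqP; nra.
  have z2 : k 2 0 = 0 by apply/eqP; rewrite -sqrf_eq0; apply/eqP; nra.
  by apply: cV3P; rewrite ?z0 ?z1 ?z2 mxE.
have aqf : dot a qf = 2 * c * (k 0 0 ^+ 2 + k 1 0 ^+ 2).
  have := gram k kf; rewrite Ak dot0v !vec3E -/a -/qf.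
  move: kk => /(congr1 ( *%R c)); lra.
have aqh : dot a qh = 0.
  have := gram k kh; rewrite Ak dot0v !vec3E -/a -/qh; lra.
have pqf : dot pf qf = 0.
  have := gram kf kf; rewrite !vec3E -/pf -/qf [dot qf _]dotC.
  by move: kk => /(congr1 ( *%R c)); lra.
have pqh : dot ph qh = c * (k 0 0 ^+ 2 + k 1 0 ^+ 2) / 2.
  by have := gram kh kh; rewrite !vec3E -/ph -/qh [dot qh _]dotC; lra.
have pqfh : dot pf qh + dot ph qf = 0.
  have := gram kf kh; rewrite !vec3E -/pf -/qf -/ph -/qh [dot qf _]dotC; lra.
have gn0 : dot a qf != 0 by rewrite aqf !mulf_neq0 // pnatr_eq0.
have etan0 : dot ph qh != 0 by rewrite pqh !mulf_neq0 // invr_neq0 // pnatr_eq0.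
have qh0 : qh != 0 by apply: contra_neq etan0 => ->; rewrite dotC dot0v.
have nh0 : dot qh qh != 0 by rewrite dot_eq0.
have nqfh : cross qf qh != 0.
  apply: contra_neq gn0 => z.
  have z' : cross qh qf = 0 by rewrite crossC z oppr0.
  by rewrite dotC (parallel_vectors qh0 z') dotZl [dot _ a]dotC aqh mulr0.
(* In the affine frame B the vectors V kf, V kh and V k become multiples of
   u, v and w; d and beta are forced by the moments of V k and V kh. *)
set d := cross a qh.
set beta := 4 * dot ph qh / (dot a qf * dot qh qh).
have beta0 : beta != 0 by rewrite !mulf_neq0 ?invr_neq0 ?mulf_neq0 // pnatr_eq0.
have dd : cross d qh = - dot qh qh *: a.
  by rewrite cross_cross aqh scale0r add0r scaleNr.
have qfd : dot (cross qf d) qh = - dot qh qh * dot a qf.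
  by rewrite dot_cross dd dotC dotZl.
(* The term in [cross qf d] will cancel the contribution of [cof B] in [Lv]; [beta] is the value for
   which the second moment is orthogonal to [qh], as the moment of a line must be. *)
have [b [bf bh]] : exists b, cross b qf = pf /\
    cross b qh = ph + (beta / 4) *: cross qf d.
  apply: point_of_moments => //.
    rewrite dotDl dotZl qfd /beta; field.
    by rewrite nh0 gn0.
  by rewrite dotDl dotZl [dot (cross qf d) qf]dotC -dot_cross cross_self dot0v
    mulr0 addr0.
(* Half sum and half difference, so that [B] sends (1, 1, 0) to [qf] and (1, -1, 0) to
   [beta *: d]. *)
set m1 := 2^-1 *: (qf + beta *: d); set m2 := 2^-1 *: (qf - beta *: d).
set B := columns_mx m1 m2 qh.
have uB : B \in unitmx.
  rewrite unitmxE unitfE det_columns_mx.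
  have E u v t : cross (2^-1 *: (u + t *: v)) (2^-1 *: (u - t *: v)) =
      - (t / 2) *: cross u v :> 'cV[R]_3.
    by apply: cV3P; rewrite !(crossE, mxE); field.
  rewrite E dotZl qfd !mulf_neq0 ?oppr_eq0 //.
  by rewrite mulf_neq0 // invr_eq0 pnatr_eq0.
have Bu : B *m vec3 1 1 0 = qf.
  rewrite mul_columns_mx !vec3E !scale1r scale0r addr0 /m1 /m2 -scalerDr.
  rewrite addrACA subrr addr0.
  by rewrite -mulr2n -scaler_nat scalerA mulVf ?pnatr_eq0 // scale1r.
have Bd : B *m vec3 1 (-1) 0 = beta *: d.
  have E u v t : 2^-1 *: (u + t *: v) - 2^-1 *: (u - t *: v) = t *: v :> 'cV[R]_3.
    by apply: cV3P; rewrite !mxE; field.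
  by rewrite mul_columns_mx !vec3E scale0r addr0 scale1r scaleN1r E.
have Bh : B *m vec3 0 0 1 = qh by rewrite mul_columns_mx !vec3E !scale0r !add0r scale1r.
have Lu : affine_plucker B b *m col_mx 0 (vec3 1 1 0) = col_mx P A *m kf.
  by rewrite affine_plucker_col mulmx0 add0r Bu bf mul_col_mx.
have Lw : affine_plucker B b *m col_mx (vec3 (-1) (-1) 0) 0 =
    col_mx P A *m ((- beta * dot qh qh) *: k).
  rewrite affine_plucker_col mulmx0 mul_col_mx -!scalemxAr Ak scaler0.
  congr col_mx.
  have -> : vec3 (-1) (-1) 0 = cross (vec3 1 (-1) 0) (vec3 0 0 1) :> 'cV[R]_3.
    by apply: cV3P; rewrite crossE !vec3E; ring.
  by rewrite -cross_mulmx // Bd Bh crossv0 addr0 crossZl dd scalerA mulrN mulNr.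
have Lv : affine_plucker B b *m col_mx (vec3 0 0 1) (vec3 0 0 2) =
    col_mx P A *m (2 *: kh).
  have e2 : vec3 0 0 2 = 2 *: vec3 0 0 1 :> 'cV[R]_3.
    by apply: cV3P; rewrite !mxE /=; ring.
  rewrite affine_plucker_col mul_col_mx -!scalemxAr e2 -scalemxAr Bh.
  congr col_mx.
  have -> : vec3 0 0 1 = (- 2^-1) *: cross (vec3 1 1 0) (vec3 1 (-1) 0) :> 'cV[R]_3.
    by apply: cV3P; rewrite [RHS]mxE crossE !vec3E; field.
  have E u v t : - 2^-1 *: (t *: v) + 2 *: (u + (t / 4) *: v) = 2 *: u :> 'cV[R]_3.
    by apply: cV3P; rewrite !mxE; field.
  by rewrite -scalemxAr -cross_mulmx // Bu Bd !crossZr bh E.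
exists B, b.
have [|U eU] := @colspan_factor (col_mx P A) (affine_plucker B b *m paraboloid_span 1);
  last by exists U.
have colE j : col j (affine_plucker B b *m paraboloid_span 1) =
    affine_plucker B b *m col j (paraboloid_span 1).
  by rewrite !colE mulmxA.
apply: ord3P; rewrite colE.
- have -> : col 0 (paraboloid_span 1) = col_mx (vec3 0 0 1) (vec3 0 0 2) :> 'cV[R]_(3 + 3).
    rewrite /paraboloid_span col_col_mx; congr col_mx;
    by apply: cV3P; rewrite !mxE.
  by rewrite Lv; exists (2 *: kh).
- have -> : col 1 (paraboloid_span 1) = col_mx (vec3 (-1) (-1) 0) 0
    - col_mx 0 (vec3 1 1 0) :> 'cV[R]_(3 + 3).
    rewrite /paraboloid_span col_col_mx opp_col_mx add_col_mx; congr col_mx;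
    by apply: cV3P; rewrite !mxE /=; ring.
  by rewrite mulmxBr Lu Lw -mulmxBr; eexists.
- have -> : col 2 (paraboloid_span 1) = col_mx (vec3 (-1) (-1) 0) 0
    + col_mx 0 (vec3 1 1 0) :> 'cV[R]_(3 + 3).
    rewrite /paraboloid_span col_col_mx add_col_mx; congr col_mx;
    by apply: cV3P; rewrite !mxE /=; ring.
  by rewrite mulmxDr Lu Lw -mulmxDr; eexists.
Qed.

(** The lower block of [V] gives the directions; it is singular exactly when [V] contains a line at
    infinity, and this separates paraboloid from hyperboloid. Only [V] has to be normalized, since
    [W] follows. *)
Lemma conjugate_gram_doubly_ruled c V W : c != 0 ->
    conjugate_gram c (row_mx V W) ->
  exists Q, nonplanar_doubly_ruled Q /\
    generating_families Q (ruling V) (ruling W).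
Proof.
move=> c0 gN; have := gN => /conjugate_gramE[gV _ _].
rewrite -[V]vsubmxK klein_form_col_mx in gV.
have det_neq0 (B : 'M[R]_3) : B \in unitmx -> \det B != 0 by rewrite -unitfE -unitmxE.
have std B b t (V0 W0 : 'M[R]_(3 + 3, 3)) U : B \in unitmx -> t != 0 ->
    conjugate_gram t (row_mx V0 W0) -> V *m U = affine_plucker B b *m V0 ->
    ruling V = affine_image B b @` ruling V0 /\
    ruling W = affine_image B b @` ruling W0.
  move=> uB t0 g0 eU; rewrite !affine_ruling //.
  apply: (@eq_ruling_of_factor _ c (\det B * t) _ _ _ _ U) => //.
    by rewrite mulf_neq0 ?det_neq0.
  by rewrite -mul_mx_row; apply: affine_conjugate_gram.
have s1 : 1 ^+ 2 = 1 :> R by rewrite expr1n.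
have n2 : 2 != 0 :> R by rewrite pnatr_eq0.
have n4 : 4 != 0 :> R by rewrite pnatr_eq0.
have [uA|nuA] := boolP (dsubmx V \in unitmx).
- have [B [b [U [uB eU]]]] := hyperboloid_factor gV c0 uA.
  rewrite vsubmxK in eU.
  have [->->] := std _ _ _ _ _ _ uB n2 (hyperboloid_gram R) eU.
  exists (affine_image B b (@hyperboloid R)); split; first by left; exists B, b.
  by apply: affine_generating => //; apply: hyperboloid_generating.
- have [B [b [U [uB eU]]]] := paraboloid_factor gV c0 nuA.
  rewrite vsubmxK in eU.
  have [->->] := std _ _ _ _ _ _ uB n4 (paraboloid_gram R) eU.
  exists (affine_image B b (@paraboloid R)); split; first by right; exists B, b.
  by apply: affine_generating => //; apply: paraboloid_generating.
Qed.

(** The affine images of the model rulings also form a generating pair of [Q], so they are [G] and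
    [G'] in some order; the exchanged order is absorbed by the sign of [c]. *)
Lemma doubly_ruled_conjugate_gram Q G G' :
    nonplanar_doubly_ruled Q -> generating_families Q G G' ->
  exists V W c, [/\ c != 0, conjugate_gram c (row_mx V W),
    G = ruling V & G' = ruling W].
Proof.
move=> ndr [neq gen].
have s1 : 1 ^+ 2 = 1 :> R by rewrite expr1n.
have n2 : 2 != 0 :> R by rewrite pnatr_eq0.
have n4 : 4 != 0 :> R by rewrite pnatr_eq0.
have [V [W [c [c0 gVW gen0]]]] : exists V W c, [/\ c != 0,
    conjugate_gram c (row_mx V W) & generating_families Q (ruling V) (ruling W)].
  have std B b c V W Q0 : B \in unitmx -> c != 0 -> conjugate_gram c (row_mx V W) ->
      generating_families Q0 (ruling V) (ruling W) ->
      exists V W c, [/\ c != 0, conjugate_gram c (row_mx V W) &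
        generating_families (affine_image B b Q0) (ruling V) (ruling W)].
    move=> uB c0 g /(affine_generating b uB); rewrite !affine_ruling // => gen0.
    exists (affine_plucker B b *m V), (affine_plucker B b *m W), (\det B * c).
    split=> //; last by rewrite -mul_mx_row; apply: affine_conjugate_gram.
    by rewrite mulf_neq0 // -unitfE -unitmxE.
  case: ndr => -[B [b [uB ->]]].
    by apply: std uB n2 (hyperboloid_gram R) _ => //; apply: hyperboloid_generating.
  by apply: std uB n4 (paraboloid_gram R) _ => //; apply: paraboloid_generating.
case: gen0 => neq0 gen0.
have /gen eV : line_foliation Q (ruling V) by apply/gen0; left.
have /gen eW : line_foliation Q (ruling W) by apply/gen0; right.
case: eV eW => eV [] eW; rewrite eV eW in neq0; try by case: neq0.
  by exists V, W, c.
by exists W, V, (- c); rewrite oppr_eq0; split=> //; apply: conjugate_gram_swap.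
Qed.

End Classification.

(** * The chart and R^{3,3} *)

Section Chart.
Variable R : realType.
Implicit Types (X Y Z p q r b k : 'cV[R]_3) (V W : 'M[R]_(3 + 3, 3)).
Implicit Types (N : 'M[R]_(3 + 3)) (c : R) (x y : 'cV[R]_4) (s t : 'cV[R]_6).
Implicit Types (M : 'M[R]_6) (l : set 'cV[R]_3) (F G : set (set 'cV[R]_3)).

Notation D := (lorentz R).
Notation H := (klein_form R).

Lemma form33E s t : form33 s t =
  s 0 0 * t 0 0 + s 1 0 * t 1 0 + s 2 0 * t 2 0
  - s 3 0 * t 3 0 - s 4 0 * t 4 0 - s 5 0 * t 5 0.
Proof.
have e1 : inord 1 = 1 :> 'I_6 by apply: val_inj; rewrite /= inordK.
have e2 : inord 2 = 2 :> 'I_6 by apply: val_inj; rewrite /= inordK.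
have e3 : inord 3 = 3 :> 'I_6 by apply: val_inj; rewrite /= inordK.
have e4 : inord 4 = 4 :> 'I_6 by apply: val_inj; rewrite /= inordK.
by rewrite /form33 /form22 !mxE /= e1 e2 e3 e4; ring.
Qed.

Lemma gram33E : gram33 R =
  rows_mx 6 6 [:: [:: 1; 0; 0; 0; 0; 0]; [:: 0; 1; 0; 0; 0; 0];
    [:: 0; 0; 1; 0; 0; 0]; [:: 0; 0; 0; -1; 0; 0];
    [:: 0; 0; 0; 0; -1; 0]; [:: 0; 0; 0; 0; 0; -1]].
Proof.
by apply/matrixP; apply: ord6P; apply: ord6P;
  rewrite !mxE form33E !mxE /=; ring.
Qed.

Lemma mulmxv6E m (M : 'M[R]_(m, 6)) s i : (M *m s) i 0 =
  M i 0 * s 0 0 + M i 1 * s 1 0 + M i 2 * s 2 0 + M i 3 * s 3 0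
  + M i 4 * s 4 0 + M i 5 * s 5 0.
Proof. by rewrite mxE sum6E. Qed.

Lemma form33_gram s t : form33 s t = (s^T *m gram33 R *m t) 0 0.
Proof.
rewrite form33E -mulmxA [RHS]mxE sum6E !mulmxv6E gram33E !mxE /=; ring.
Qed.

Lemma gram33_entry m n (A : 'M[R]_(6, m)) (B : 'M[R]_(6, n)) i j :
  (A^T *m gram33 R *m B) i j =
  A 0 i * B 0 j + A 1 i * B 1 j + A 2 i * B 2 j
  - A 3 i * B 3 j - A 4 i * B 4 j - A 5 i * B 5 j.
Proof.
transitivity (form33 (col i A) (col j B)); last by rewrite form33E !mxE.
rewrite form33_gram !colE trmx_mul trmx_delta.
set ei := delta_mx 0 i; set ej := delta_mx j 0.
have -> : ei *m A^T *m gram33 R *m (B *m ej) =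
    ei *m (A^T *m gram33 R *m B *m ej) by rewrite !mulmxA.
by rewrite -rowE -colE !mxE.
Qed.

Lemma Opm33_form33 M : Opm33 M ->
  exists2 e, e != 0 & forall s t, form33 (M *m s) (M *m t) = e * form33 s t.
Proof.
have E e s t : M^T *m gram33 R *m M = e *: gram33 R ->
    form33 (M *m s) (M *m t) = e * form33 s t.
  move=> eM; rewrite !form33_gram.
  have -> : (M *m s)^T *m gram33 R *m (M *m t) =
      s^T *m (M^T *m gram33 R *m M) *m t by rewrite trmx_mul !mulmxA.
  by rewrite eM -scalemxAr -scalemxAl mxE.
case=> _ [] e; [exists 1; rewrite ?oner_neq0 |
  exists (-1); rewrite ?oppr_eq0 ?oner_neq0] => // s t; apply: E.
  by rewrite scale1r.
by rewrite scaleN1r.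
Qed.

Lemma lift33E x :
  (lift33 x 0 0 = (1 - sqnorm22 x) / 2) * (lift33 x 1 0 = x 0 0) *
  (lift33 x 2 0 = x 1 0) * (lift33 x 3 0 = x 2 0) *
  (lift33 x 4 0 = x 3 0) * (lift33 x 5 0 = (1 + sqnorm22 x) / 2).
Proof. by rewrite /lift33 !mxE. Qed.

Lemma cV6P s t : s 0 0 = t 0 0 -> s 1 0 = t 1 0 -> s 2 0 = t 2 0 ->
  s 3 0 = t 3 0 -> s 4 0 = t 4 0 -> s 5 0 = t 5 0 -> s = t.
Proof. by move=> *; apply/colP; apply: ord6P. Qed.

Lemma cV4P x y : x 0 0 = y 0 0 -> x 1 0 = y 1 0 -> x 2 0 = y 2 0 ->
  x 3 0 = y 3 0 -> x = y.
Proof.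
move=> e0 e1 e2 e3; apply/colP=> -[[|[|[|[|//]]]] lti];
  [move: e0 | move: e1 | move: e2 | move: e3];
  by congr (x _ _ = y _ _); apply: val_inj.
Qed.

Lemma form33_lift33 x : form33 (lift33 x) (lift33 x) = 0.
Proof. by rewrite form33E !lift33E /sqnorm22 /form22; field. Qed.

Lemma lift33_neq0 x : lift33 x != 0.
Proof.
apply: contra_neq (oner_neq0 R) => /colP e.
have := e 0; have := e 5; rewrite !lift33E !mxE; lra.
Qed.

(** * The isometry from Pluecker coordinates to R^{3,3} *)

Definition moment33 : 'M[R]_(6, 3) :=
  rows_mx 6 3 [:: [:: 0; 0; 2]; [:: 0; 1; 0]; [:: -1; 0; 0]; [:: 0; 1; 0];
    [:: -1; 0; 0]; [:: 0; 0; -2]].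

Definition direction33 : 'M[R]_(6, 3) :=
  rows_mx 6 3 [:: [:: 0; 0; 2^-1]; [:: 0; 1; 0]; [:: -1; 0; 0]; [:: 0; -1; 0];
    [:: 1; 0; 0]; [:: 0; 0; 2^-1]].

(** The chart in homogeneous form: s_1, ..., s_4 are its numerators, s_0 + s_5 = q_2 is its
    denominator, and s_5 - s_0 = -4 p_2 equals q_2 times the squared norm of the chart point when
    p.q = 0 and q_2 is nonzero. *)
Definition plucker33 : 'M[R]_(6, 3 + 3) := row_mx moment33 direction33.

Lemma plucker33E p q :
  ((plucker33 *m col_mx p q) 0 0 = 2 * p 2 0 + q 2 0 / 2) *
  ((plucker33 *m col_mx p q) 1 0 = p 1 0 + q 1 0) *
  ((plucker33 *m col_mx p q) 2 0 = - p 0 0 - q 0 0) *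
  ((plucker33 *m col_mx p q) 3 0 = p 1 0 - q 1 0) *
  ((plucker33 *m col_mx p q) 4 0 = - p 0 0 + q 0 0) *
  ((plucker33 *m col_mx p q) 5 0 = - 2 * p 2 0 + q 2 0 / 2).
Proof.
rewrite mul_row_col.
by do !split; rewrite [LHS]mxE !mulmxv3E !mxE /=; ring.
Qed.

Lemma plucker33_gram : plucker33^T *m gram33 R *m plucker33 = 2 *: H.
Proof.
rewrite tr_row_mx mul_col_mx mul_col_row scale_block_mx !scaler0.
congr block_mx; apply/matrixP; apply: ord3P; apply: ord3P;
  by rewrite gram33_entry !mxE /=; field.
Qed.

(** The span of the lifts (0, alpha_1, alpha_2, 0, 0, 1) of the points of [circle0], whose squared
    norm is 1. On [circle0_perp] the squared norm is -1, so there s_0 = 1 and s_5 = 0. *)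
Definition circle_plane : 'M[R]_(6, 3) :=
  rows_mx 6 3 [:: [:: 0; 0; 0]; [:: 1; 0; 0]; [:: 0; 1; 0]; [:: 0; 0; 0];
    [:: 0; 0; 0]; [:: 0; 0; 1]].

Definition circle_perp_plane : 'M[R]_(6, 3) :=
  rows_mx 6 3 [:: [:: 0; 0; 1]; [:: 0; 0; 0]; [:: 0; 0; 0]; [:: 1; 0; 0];
    [:: 0; 1; 0]; [:: 0; 0; 0]].

Definition planes33 : 'M[R]_(6, 3 + 3) := row_mx circle_plane circle_perp_plane.

Lemma planes33_gram :
  planes33^T *m gram33 R *m planes33 = block_mx D 0 0 (- D).
Proof.
rewrite tr_row_mx mul_col_mx mul_col_row.
congr block_mx; apply/matrixP; apply: ord3P; apply: ord3P;
  by rewrite gram33_entry !mxE /=; ring.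
Qed.

Lemma gram33_unit : gram33 R \in unitmx.
Proof.
have : @mulmx R 6 6 6 (@mulmx R 6 6 6 planes33^T (gram33 R)) planes33 \in unitmx.
  by have := signature_unit R; rewrite -planes33_gram.
by rewrite !unitmx_mul => /andP[/andP[_ ->]].
Qed.

Lemma planes33_orthogonal : planes33 *m planes33^T = 1%:M.
Proof.
rewrite tr_row_mx mul_row_col; apply/matrixP; apply: ord6P; apply: ord6P;
  rewrite !mxE !sum3E !mxE /=; ring.
Qed.

Lemma plucker33_inj (A B : 'M[R]_(3 + 3, 1)) :
  plucker33 *m A = plucker33 *m B -> A = B.
Proof.
move=> e; have : plucker33^T *m gram33 R *m plucker33 *m A =
  plucker33^T *m gram33 R *m plucker33 *m B by rewrite -!mulmxA e.
rewrite plucker33_gram -!scalemxAl => /(scalerI _) e'.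
by apply: (can_inj (mulKmx (klein_form_unit R))); apply: e'; rewrite pnatr_eq0.
Qed.

Lemma lift33_chart p q : q 2 0 != 0 -> dot p q = 0 ->
  lift33 (chart p q) = (q 2 0)^-1 *: (plucker33 *m col_mx p q).
Proof.
move=> q2 pq; have e2 : p 2 0 = - (p 0 0 * q 0 0 + p 1 0 * q 1 0) / q 2 0.
  by apply: (mulIf q2); rewrite divfK //; move: pq; rewrite /dot; lra.
apply: cV6P; rewrite [RHS]mxE plucker33E lift33E /sqnorm22 /form22 ?e2 !mxE /=;
  by field.
Qed.

Lemma dot_moment X q : dot (cross X q) q = 0.
Proof. by rewrite dot_cross cross_self dotC dot0v. Qed.

(** The lift of [x] recovers the Pluecker vector scaled to third direction coordinate 1, and this
    determines the line. *)
Lemma point_of_line_inj l l' x :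
  point_of_line l x -> point_of_line l' x -> l = l'.
Proof.
move=> [X [q [q2 -> ex]]] [Y [r [r2 -> ey]]].
have := congr1 (@lift33 R) (etrans (esym ex) ey).
rewrite !lift33_chart ?dot_moment // !scalemxAr => /plucker33_inj.
rewrite !scale_col_mx => /eq_col_mx[em ed].
have r0 : r != 0 by apply: contra_neq r2 => ->; rewrite mxE.
set a := (r 2 0)^-1 in em ed; have a0 : a != 0 by rewrite invr_eq0.
have b0 : (q 2 0)^-1 != 0 by rewrite invr_eq0.
rewrite (line_rebase b0 (line_base X q)) (line_rebase a0 (line_base Y r)) ed.
by apply: eq_line_moment; rewrite ?scaler_eq0 ?negb_or ?a0 // -{1}ed !crossZr.
Qed.

(** * Point sets of families of lines *)

Definition points F : set 'cV[R]_4 :=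
  [set x | exists2 l, F l & point_of_line l x].

(** The chart sees only nonhorizontal lines, and it is injective on them. *)
Lemma same_nonhorizontal_points F G :
  same_nonhorizontal F G <-> points F = points G.
Proof.
have sub F1 G1 : F1 `&` @nonhorizontal_lines R `<=` G1 -> points F1 `<=` points G1.
  move=> sub x [l Fl xl]; exists l => //; apply: sub; split=> //.
  by case: xl => X [q [q2 el _]]; exists X, q.
have sub' F1 G1 : points F1 `<=` points G1 ->
    F1 `&` @nonhorizontal_lines R `<=` G1 `&` @nonhorizontal_lines R.
  move=> sub' l [Fl nl]; split=> //; case: nl => X [q [q2 el]].
  have lx : point_of_line l (chart (cross X q) q) by exists X, q.
  have [l' Gl' l'x] : points G1 (chart (cross X q) q) by apply: sub'; exists l.
  by rewrite (point_of_line_inj lx l'x).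
split=> [e|e]; apply/seteqP; split.
- by apply: sub; rewrite e => l [].
- by apply: sub; rewrite -e => l [].
- by apply: sub'; rewrite e.
- by apply: sub'; rewrite e.
Qed.

Lemma points_ruling V :
  points (ruling V) = [set x | exists k, lift33 x = plucker33 *m (V *m k)].
Proof.
apply/seteqP; split=> x.
  move=> [l Vl [X [q [q2 el ->]]]].
  have q0 : q != 0 by apply: contra_neq q2 => ->; rewrite mxE.
  move: Vl; rewrite el => /(rulingE _ _ q0)[k ek]; exists ((q 2 0)^-1 *: k).
  by rewrite lift33_chart ?dot_moment // -!scalemxAr -ek.
move=> [k].
have [p [q epq]] : exists p q, V *m k = col_mx p q.
  by exists (usubmx (V *m k)), (dsubmx (V *m k)); rewrite vsubmxK.
rewrite epq => ex.
have E i : lift33 x i 0 = (plucker33 *m col_mx p q) i 0 by rewrite ex.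
have := (E 0, E 1, E 2, E 3, E 4, E 5); rewrite !plucker33E !lift33E.
move=> [[[[[E0 E1] E2] E3] E4] E5].
(* The normalization s_0 + s_5 = 1 of a lift becomes q_2 = 1, and its nullity becomes p.q = 0; hence
   (p, q) is the Pluecker vector of a nonhorizontal line. *)
have q2 : q 2 0 = 1 by lra.
have pq : dot p q = 0.
  have := form33_lift33 x; rewrite ex form33E !plucker33E /dot; lra.
have q2n : q 2 0 != 0 by rewrite q2 oner_neq0.
have q0 : q != 0 by apply: contra_neq q2n => ->; rewrite mxE.
have [X eX] := line_of_moment q0 pq.
exists (line X q).
  by apply/rulingE => //; exists k; rewrite /plucker eX epq.
exists X, q; split=> //; rewrite eX; apply: cV4P;
  by rewrite !mxE /= q2 divr1 ?E1 ?E2 ?E3 ?E4.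
Qed.

(** * Conformal images of the two standard circles *)

Definition vec4 (a b c d : R) : 'cV[R]_4 := \col_(i < 4) [:: a; b; c; d]`_i.

Lemma vec4E (a b c d : R) : (vec4 a b c d 0 0 = a) * (vec4 a b c d 1 0 = b) *
  (vec4 a b c d 2 0 = c) * (vec4 a b c d 3 0 = d).
Proof. by rewrite /vec4 !mxE. Qed.

(** The nonzero null vectors of the plane of [B] are multiples of lifts of points of [C], and [M]
    preserves nullity in both directions. Points sent to infinity drop out by themselves, since
    every lift has s_0 + s_5 = 1. *)
Lemma conformal_image_plane M (B : 'M[R]_(6, 3)) (C : set 'cV[R]_4) : Opm33 M ->
    (forall x, C x -> exists k, lift33 x = B *m k) ->
    (forall k, B *m k != 0 -> form33 (B *m k) (B *m k) = 0 ->
      exists2 x, C x & exists2 a, a != 0 & B *m k = a *: lift33 x) ->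
  conformal_image M C = [set y | exists k, lift33 y = M *m B *m k].
Proof.
move=> OM CB BC; apply/seteqP; split=> y.
  move=> [x /CB[k ek] [c [_ ey]]]; exists (c *: k).
  by rewrite ey ek -mulmxA -!scalemxAr.
move=> [k ek]; have [e e0 eM] := Opm33_form33 OM.
have [||x Cx [a a0 ea]] := BC k.
- by apply: contra_neq (lift33_neq0 y) => z; rewrite ek -mulmxA z mulmx0.
- by apply: (mulfI e0); rewrite -eM mulmxA -ek form33_lift33 mulr0.
- by exists x => //; exists a; split=> //; rewrite ek -mulmxA ea -scalemxAr.
Qed.

Lemma sqr_sum_neq0 (a b c : R) : a ^+ 2 + b ^+ 2 = c ^+ 2 ->
  ~ (a = 0 /\ b = 0 /\ c = 0) -> c != 0.
Proof.
move=> e n0; apply/eqP => c0; apply: n0; rewrite c0 in e *.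
by split; [|split=> //]; apply/eqP; rewrite -sqrf_eq0; apply/eqP; nra.
Qed.

Lemma conformal_image_circle0 M : Opm33 M ->
  conformal_image M (@circle0 R) =
  [set y | exists k, lift33 y = M *m circle_plane *m k].
Proof.
move=> OM; apply: conformal_image_plane => //.
- move=> x [e [e2 e3]]; exists (vec3 (x 0 0) (x 1 0) 1).
  have n1 : sqnorm22 x = 1 by rewrite /sqnorm22 /form22 e2 e3 -e; ring.
  by apply: cV6P; rewrite lift33E mulmxv3E !mxE /= ?n1 ?e2 ?e3; field.
- move=> k n0; rewrite form33E !mulmxv3E !mxE /= => z.
  have e : k 0 0 ^+ 2 + k 1 0 ^+ 2 = k 2 0 ^+ 2 by lra.
  have k2 : k 2 0 != 0.
    apply: sqr_sum_neq0 e _ => -[z0 [z1 z2]]; case/eqP: n0.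
    by rewrite (_ : k = 0) ?mulmx0 //; apply: cV3P; rewrite mxE.
  have e1 : (k 0 0 / k 2 0) ^+ 2 + (k 1 0 / k 2 0) ^+ 2 = 1.
    by rewrite !expr_div_n -mulrDl e mulfV // expf_neq0.
  exists (vec4 (k 0 0 / k 2 0) (k 1 0 / k 2 0) 0 0).
    by rewrite /circle0 /= !vec4E.
  exists (k 2 0) => //.
  have n1 : sqnorm22 (vec4 (k 0 0 / k 2 0) (k 1 0 / k 2 0) 0 0) = 1.
    by rewrite /sqnorm22 /form22 !vec4E -e1; ring.
  by apply: cV6P; rewrite [RHS]mxE lift33E mulmxv3E ?n1 ?vec4E !mxE /=; field.
Qed.

Lemma conformal_image_circle0_perp M : Opm33 M ->
  conformal_image M (@circle0_perp R) =
  [set y | exists k, lift33 y = M *m circle_perp_plane *m k].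
Proof.
move=> OM; apply: conformal_image_plane => //.
- move=> x [e0 [e1 e]]; exists (vec3 (x 2 0) (x 3 0) 1).
  have n1 : sqnorm22 x = -1 by rewrite /sqnorm22 /form22 e0 e1 -e; ring.
  by apply: cV6P; rewrite lift33E mulmxv3E !mxE /= ?n1 ?e0 ?e1; field.
- move=> k n0; rewrite form33E !mulmxv3E !mxE /= => z.
  have e : k 0 0 ^+ 2 + k 1 0 ^+ 2 = k 2 0 ^+ 2 by lra.
  have k2 : k 2 0 != 0.
    apply: sqr_sum_neq0 e _ => -[z0 [z1 z2]]; case/eqP: n0.
    by rewrite (_ : k = 0) ?mulmx0 //; apply: cV3P; rewrite mxE.
  have e1 : (k 0 0 / k 2 0) ^+ 2 + (k 1 0 / k 2 0) ^+ 2 = 1.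
    by rewrite !expr_div_n -mulrDl e mulfV // expf_neq0.
  exists (vec4 0 0 (k 0 0 / k 2 0) (k 1 0 / k 2 0)).
    by rewrite /circle0_perp /= !vec4E.
  exists (k 2 0) => //.
  have n1 : sqnorm22 (vec4 0 0 (k 0 0 / k 2 0) (k 1 0 / k 2 0)) = -1.
    by rewrite /sqnorm22 /form22 !vec4E -e1; ring.
  by apply: cV6P; rewrite [RHS]mxE lift33E mulmxv3E ?n1 ?vec4E !mxE /=; field.
Qed.

Lemma conjugate_conicsP (S S' : set 'cV[R]_4) :
  conjugate_conics S S' <->
  exists V W c, [/\ c != 0, conjugate_gram c (row_mx V W),
    S = points (ruling V) & S' = points (ruling W)].
Proof.
have T2 : 2 != 0 :> R by rewrite pnatr_eq0.
split=> [[M [OM -> ->]]|[V [W [c [c0 gN -> ->]]]]].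
(* The Gram identity [plucker33_gram] exhibits this inverse of [plucker33]. *)
- pose L : 'M[R]_(3 + 3, 6) := 2^-1 *: (H *m plucker33^T *m gram33 R).
  have LT : L *m plucker33 = 1%:M.
    by rewrite -scalemxAl -!mulmxA [_^T *m _]mulmxA plucker33_gram -scalemxAr
      scalerA mulVf // scale1r klein_form_sqr.
  have TL : plucker33 *m L = 1%:M by apply: mulmx1C.
  have [N eN] : exists N, M *m planes33 = plucker33 *m N.
    by exists (L *m (M *m planes33)); rewrite mulmxA TL mul1mx.
  have [e e0 eM] : exists2 e, e != 0 & M^T *m gram33 R *m M = e *: gram33 R.
    by case: OM => _ [] ->; [exists 1; rewrite ?oner_neq0 ?scale1r // |
      exists (-1); rewrite ?oppr_eq0 ?oner_neq0 ?scaleN1r //].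
  have gN : conjugate_gram (e / 2) N.
    rewrite /conjugate_gram; apply: (scalerI T2).
    have -> : 2 *: (N^T *m H *m N) = N^T *m (2 *: H) *m N.
      by rewrite -scalemxAr -scalemxAl.
    rewrite -plucker33_gram.
    have -> : N^T *m (plucker33^T *m gram33 R *m plucker33) *m N =
      (plucker33 *m N)^T *m gram33 R *m (plucker33 *m N) by rewrite trmx_mul !mulmxA.
    rewrite -eN.
    have -> : (M *m planes33)^T *m gram33 R *m (M *m planes33) =
      planes33^T *m (M^T *m gram33 R *m M) *m planes33 by rewrite trmx_mul !mulmxA.
    by rewrite eM -scalemxAr -scalemxAl planes33_gram scalerA mulrC divfK.
  exists (lsubmx N), (rsubmx N), (e / 2); rewrite hsubmxK; split=> //.
  + by rewrite mulf_neq0 // invr_eq0.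
  + rewrite conformal_image_circle0 // points_ruling.
    have -> : M *m circle_plane = plucker33 *m lsubmx N.
      by rewrite mulmx_lsub -eN mul_mx_row row_mxKl.
    by apply/seteqP; split=> y [k ey]; exists k; rewrite ey mulmxA.
  + rewrite conformal_image_circle0_perp // points_ruling.
    have -> : M *m circle_perp_plane = plucker33 *m rsubmx N.
      by rewrite mulmx_rsub -eN mul_mx_row row_mxKr.
    by apply/seteqP; split=> y [k ey]; exists k; rewrite ey mulmxA.
- set N := row_mx V W in gN.
  (* The Gram factor of [plucker33 *m N] is 2 c relative to the standard planes; scaling by [a]
     turns it into the sign of [c]. *)
  pose a := (Num.sqrt (2 * `|c|))^-1.
  have a0 : a != 0.
    by rewrite invr_eq0 sqrtr_eq0 -ltNge mulr_gt0 ?normr_gt0.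
  have a2 : a ^+ 2 * (2 * `|c|) = 1.
    by rewrite exprVn sqr_sqrtr ?mulr_ge0 // mulVf // mulf_neq0 ?normr_eq0.
  (* [planes33] is an orthogonal matrix, so its transpose sends the standard planes to coordinate
     planes, and [M] sends them on to the images of [V] and [W]. *)
  pose M : 'M[R]_6 := a *: (plucker33 *m N *m planes33^T).
  have eM : M *m planes33 = a *: (plucker33 *m N).
    have e1 : planes33^T *m planes33 = 1%:M by apply: mulmx1C; apply: planes33_orthogonal.
    by rewrite -scalemxAl -mulmxA e1 mulmx1.
  have gM : M^T *m gram33 R *m M = (a ^+ 2 * (2 * c)) *: gram33 R.
    have -> : M^T *m gram33 R *m M = a ^+ 2 *: (planes33 *m (N^T *m
        (plucker33^T *m gram33 R *m plucker33) *m N) *m planes33^T).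
      have -> : M^T = a *: (plucker33 *m N *m planes33^T)^T.
        by apply/matrixP => i j; rewrite !mxE.
      by rewrite /M -!scalemxAl -scalemxAr scalerA !trmx_mul trmxK !mulmxA.
    rewrite plucker33_gram -scalemxAr -scalemxAl gN -planes33_gram scalerA.
    rewrite -scalemxAr -scalemxAl scalerA mulrA; congr (_ *: _).
    rewrite !mulmxA planes33_orthogonal mul1mx -mulmxA planes33_orthogonal.
    exact: mulmx1.
  have OM : Opm33 M.
    have [ec|ec] : a ^+ 2 * (2 * c) = 1 \/ a ^+ 2 * (2 * c) = -1.
      have [cp|cn] := lerP 0 c; [left|right].
        by move: a2; rewrite ger0_norm.
      by move: a2; rewrite ltr0_norm // !mulrN => /eqP; rewrite eqr_oppLR => /eqP.
    - rewrite ec scale1r in gM; split; last by left.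
      exact: gram_unitmx gM gram33_unit.
    - rewrite ec scaleN1r in gM; split; last by right.
      apply: gram_unitmx gM _.
      by rewrite -scaleN1r unitmxZ ?gram33_unit // unitrN1.
  exists M; split=> //.
  + rewrite conformal_image_circle0 // points_ruling.
    have -> : M *m circle_plane = a *: (plucker33 *m V).
      by have := congr1 lsubmx eM; rewrite !mul_mx_row row_mxKl scale_row_mx row_mxKl.
    apply/seteqP; split=> y [k ey].
      exists (a^-1 *: k).
      by rewrite ey -scalemxAl -scalemxAr scalerA mulfV // scale1r mulmxA.
    by exists (a *: k); rewrite ey -scalemxAl -!scalemxAr mulmxA.
  + rewrite conformal_image_circle0_perp // points_ruling.
    have -> : M *m circle_perp_plane = a *: (plucker33 *m W).
      by have := congr1 rsubmx eM; rewrite !mul_mx_row row_mxKr scale_row_mx row_mxKr.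
    apply/seteqP; split=> y [k ey].
      exists (a^-1 *: k).
      by rewrite ey -scalemxAl -scalemxAr scalerA mulfV // scale1r mulmxA.
    by exists (a *: k); rewrite ey -scalemxAl -!scalemxAr mulmxA.
Qed.

End Chart.

Theorem theorem1p3 (R : realType) (S Sperp : set 'cV[R]_4)
    (L Lperp : set (set 'cV[R]_3))
    (L_lines : L `<=` @lines R) (Lperp_lines : Lperp `<=` @lines R)
    (S_L : represents S L) (Sperp_Lperp : represents Sperp Lperp) :
  conjugate_conics S Sperp <->
  exists (Q : set 'cV[R]_3) (G Gperp : set (set 'cV[R]_3)),
    [/\ nonplanar_doubly_ruled Q, generating_families Q G Gperp,
        same_nonhorizontal L G & same_nonhorizontal Lperp Gperp].
Proof.
have eS : S = points L := S_L; have eSp : Sperp = points Lperp := Sperp_Lperp.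
rewrite eS eSp; split.
  move=> /conjugate_conicsP[V [W [c [c0 gN eV eW]]]].
  have [Q [ndr gen]] := conjugate_gram_doubly_ruled c0 gN.
  (* Equality of point sets constrains only the nonhorizontal lines, which is all that
     [same_nonhorizontal] asks. *)
  by exists Q, (ruling V), (ruling W); split=> //; apply/same_nonhorizontal_points.
move=> [Q [G [G' [ndr gen]]]].
move=> /same_nonhorizontal_points eL /same_nonhorizontal_points eL'.
apply/conjugate_conicsP; rewrite eL eL'.
have [V [W [c [c0 gN -> ->]]]] := doubly_ruled_conjugate_gram ndr gen.
by exists V, W, c.
Qed.
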